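(* Let $c_0>0$ be a sufficiently large constant and $\delta>0$, and suppose $c_0/n<p\leq n^{-5/6-\delta}$. Then each of $\bar\vartheta_{1/2}(G(n,p))$, $\bar\vartheta(G(n,p))$, $\bar\vartheta_2(G(n,p))$ is concentrated in width $1$: for each $X\in\{\bar\vartheta_{1/2},\bar\vartheta,\bar\vartheta_2\}$ there is a number $u=u_X(n,p)$ such that $\Pr(u\leq X(G(n,p))\leq u+1)=1-o(1)$ as $n\to\infty$.
   Context: $G(n,p)$ is the random graph on $V=\{1,\dots,n\}$ with each possible edge present independently with probability $p$. For a graph $G=(V,E)$ and a real $k>1$, an $n$-tuple $(v_1,\dots,v_n)$ of unit vectors in $\mathbb R^n$ is a vector $k$-coloring if $\langle v_i,v_j\rangle\leq-1/(k-1)$ for all $\{i,j\}\in E$; strict if $\langle v_i,v_j\rangle=-1/(k-1)$ for all $\{i,j\}\in E$; rigid if equality holds on all edges and $\langle v_i,v_j\rangle\geq-1/(k-1)$ for all non-adjacent $i\neq j$. $\bar\vartheta_{1/2}(G)$ (the vector chromatic number), $\bar\vartheta(G)$, $\bar\vartheta_2(G)$ denote the infimum of $k>1$ such that $G$ admits a vector, strict vector, resp. rigid vector $k$-coloring. *)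

(* Defs.v *)
From HB Require Import structures.
From mathcomp Require Import all_boot all_order all_algebra.
From mathcomp Require Import all_classical all_reals all_analysis.
Set Implicit Arguments. Unset Strict Implicit. Unset Printing Implicit Defensive.
Import Order.TTheory GRing.Theory Num.Theory.
Local Open Scope ring_scope.


(* A (simple) graph on V = 'I_n is a set E of 2-element subsets of 'I_n. *)
Definition pairs (n : nat) : {set {set 'I_n}} := [set e : {set 'I_n} | #|e| == 2%N].

Definition gnp_prob (R : realType) (n : nat) (p : R)
    (P : {set {set 'I_n}} -> bool) : R :=
  \sum_(E in powerset (pairs n) | P E)
     p ^+ #|E| * (1 - p) ^+ (#|pairs n| - #|E|).

Definition dotv (R : realType) (n : nat) (x y : 'rV[R]_n) : R :=
  \sum_(j < n) x 0 j * y 0 j.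

Definition unit_vectors (R : realType) (n : nat) (v : 'I_n -> 'rV[R]_n) :=
  forall i, dotv (v i) (v i) = 1.

Definition vector_coloring (R : realType) (n : nat) (E : {set {set 'I_n}})
    (k : R) (v : 'I_n -> 'rV[R]_n) : Prop :=
  unit_vectors v /\
  forall i j : 'I_n, [set i; j] \in E -> dotv (v i) (v j) <= - (k - 1)^-1.

Definition strict_vector_coloring (R : realType) (n : nat) (E : {set {set 'I_n}})
    (k : R) (v : 'I_n -> 'rV[R]_n) : Prop :=
  unit_vectors v /\
  forall i j : 'I_n, [set i; j] \in E -> dotv (v i) (v j) = - (k - 1)^-1.

Definition rigid_vector_coloring (R : realType) (n : nat) (E : {set {set 'I_n}})
    (k : R) (v : 'I_n -> 'rV[R]_n) : Prop :=
  unit_vectors v /\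
  (forall i j : 'I_n, [set i; j] \in E -> dotv (v i) (v j) = - (k - 1)^-1) /\
  (forall i j : 'I_n, i != j -> [set i; j] \notin E ->
      - (k - 1)^-1 <= dotv (v i) (v j)).

Definition theta_half (R : realType) (n : nat) (E : {set {set 'I_n}}) : R :=
  inf ([set k : R | 1 < k /\ exists v, vector_coloring E k v]%classic).

Definition theta_bar (R : realType) (n : nat) (E : {set {set 'I_n}}) : R :=
  inf ([set k : R | 1 < k /\ exists v, strict_vector_coloring E k v]%classic).

Definition theta_2 (R : realType) (n : nat) (E : {set {set 'I_n}}) : R :=
  inf ([set k : R | 1 < k /\ exists v, rigid_vector_coloring E k v]%classic).

(* Main.v *)
Require Import Defs.
From HB Require Import structures.
From mathcomp Require Import all_boot all_order all_algebra.
From mathcomp Require Import all_classical all_reals all_analysis.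
From mathcomp Require Import fintype finset ring lra zify.
Set Implicit Arguments. Unset Strict Implicit. Unset Printing Implicit Defensive.
Import Order.TTheory GRing.Theory Num.Theory numFieldNormedType.Exports.
Local Open Scope ring_scope.

(** Fix eps = n^-delta and let u be the least value with P(X <= u) >= eps, so that P(X < u) < eps.
    The number of vertices at which G must be changed to reach {X <= u} is 1-Lipschitz under vertex
    exposure, hence of variance at most n; as it vanishes with probability at least eps, by
    Chebyshev's inequality it is at most 2 n^(1/2+delta/2) outside an event of probability eps.  So
    typically some S of that size makes G - S vector u-colorable.  For p <= n^(-5/6-delta) every
    vertex set of size at most n^(1/2+delta) spans fewer than (3/2 - 1/(2M)) edges per vertex.
    Hence S can be enlarged (Luczak's trick) to a set U of that size whose outside neighbourhood is
    independent, and U is 3-colorable.  One extra color for the neighbourhood of U turns the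
    coloring outside U and the 3-coloring of U into a vector (u+1)-coloring, provided u >= 3.
    This last condition is what p > c0/n is for: a vector k-coloring with k < 3 rounds to a cut
    containing a fraction of the edges bounded away from 1/2 from below, which a first moment
    bound over all 2^n cuts rules out. *)

(** * Random subsets *)

Lemma setU1_ind (T : finType) (P : {set T} -> Prop) :
  P set0 -> (forall x (D : {set T}), x \notin D -> P D -> P (x |: D)) -> forall D, P D.
Proof.
move=> P0 PS D; have [m] := ubnP #|D|; elim: m D => // m IH D leDm.
have [->//|[x xD]] := set_0Vmem D.
rewrite -(setD1K xD); apply: PS; first by rewrite !inE eqxx.
by apply: IH; rewrite (cardsD1 x) xD in leDm.
Qed.

Section RandomSubset.
Variables (R : realType) (T : finType) (p : R).
Implicit Types (D E : {set T}) (f g : {set T} -> R).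

Definition Ex D f : R :=
  \sum_(E in powerset D) p ^+ #|E| * (1 - p) ^+ (#|D| - #|E|) * f E.

Lemma Ex_set0 f : Ex set0 f = f set0.
Proof.
rewrite /Ex powerset0 big_set1 cards0 !expr0; ring.
Qed.

(** Conditioning on whether [x] is drawn; the inductions on [D] rest on this recursion. *)
Lemma ExU1 x D f : x \notin D ->
  Ex (x |: D) f = p * Ex D (fun E => f (x |: E)) + (1 - p) * Ex D f.
Proof.
move=> xD; rewrite /Ex (bigID (fun E : {set T} => x \in E)) /=; congr (_ + _).
  rewrite (reindex_onto (fun E => x |: E) (fun E => E :\ x)) /=; last first.
    by move=> E /andP[_ xE]; rewrite setD1K.
  rewrite big_distrr /=; apply: eq_big => [E|E].
    rewrite !inE eqxx /= andbT; apply/andP/idP => [[sE /eqP eE]|sE].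
      rewrite -eE; apply/subsetP => y; rewrite !inE => /andP[nyx yE].
      by have := subsetP sE y; rewrite !inE (negbTE nyx); move: yE => /orP[|->];
         [rewrite (negbTE nyx) | exact].
    split; first by apply: setUS.
    by rewrite setU1K //; apply: contra xD; apply: (subsetP sE).
  move=> /andP[/andP[sE _] /eqP eE].
  have xE : x \notin E by rewrite -eE !inE eqxx.
  rewrite !cardsU1 xE xD /= !add1n subSS exprS; ring.
rewrite big_distrr /=; apply: eq_big => [E|E].
  rewrite !inE; apply/andP/idP => [[sE xE]|sE].
    apply/subsetP => y yE; have := subsetP sE y yE; rewrite !inE => /orP[/eqP yx|//].
    by rewrite -yx yE in xE.
  split; first by apply: subset_trans sE (subsetUr _ _).
  by apply: contra xD; apply: (subsetP sE).
rewrite !inE => /andP[sE xE].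
have sED : E \subset D.
  apply/subsetP => y yE; have := subsetP sE y yE; rewrite !inE => /orP[/eqP yx|//].
  by rewrite -yx yE in xE.
rewrite cardsU1 xD /= add1n subSn ?subset_leq_card // exprS; ring.
Qed.

Lemma eq_Ex D f g : (forall E, E \subset D -> f E = g E) -> Ex D f = Ex D g.
Proof. by move=> fg; apply: eq_bigr => E; rewrite inE => /fg ->. Qed.

Lemma ExD D f g : Ex D (fun E => f E + g E) = Ex D f + Ex D g.
Proof. by rewrite /Ex -big_split; apply: eq_bigr => E _; rewrite mulrDr. Qed.

Lemma ExZ D a f : Ex D (fun E => a * f E) = a * Ex D f.
Proof. by rewrite /Ex big_distrr; apply: eq_bigr => E _ /=; ring. Qed.

Lemma Ex_sum (I : Type) (r : seq I) (P : pred I) D (F : I -> {set T} -> R) :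
  Ex D (fun E => \sum_(i <- r | P i) F i E) = \sum_(i <- r | P i) Ex D (F i).
Proof. by rewrite /Ex exchange_big; apply: eq_bigr => E _; rewrite big_distrr. Qed.

Lemma Ex_cst D a : Ex D (fun=> a) = a.
Proof.
elim/setU1_ind: D => [|x D xD IH]; first exact: Ex_set0.
by rewrite ExU1 // IH; ring.
Qed.

Lemma Ex_setU D1 D2 f : [disjoint D1 & D2] ->
  Ex (D1 :|: D2) f = Ex D1 (fun A => Ex D2 (fun B => f (A :|: B))).
Proof.
elim/setU1_ind: D1 f => [|x D xD IH] f.
  by rewrite Ex_set0 set0U => _; apply: eq_Ex => E _; rewrite set0U.
rewrite -setI_eq0 setIUl setU_eq0 !setI_eq0 disjoints1 => /andP[xD2 dD].
rewrite -setUA !ExU1 ?inE ?negb_or ?xD // !IH //; congr (_ * _ + _).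
by apply: eq_Ex => A _; apply: eq_Ex => B _; rewrite setUA.
Qed.

Lemma Ex_prod D (g : T -> bool -> R) :
  Ex D (fun E => \prod_(e in D) g e (e \in E)) =
  \prod_(e in D) (p * g e true + (1 - p) * g e false).
Proof.
elim/setU1_ind: D => [|x D xD IH]; first by rewrite Ex_set0 !big_set0.
rewrite ExU1 // big_setU1 //= -IH [RHS]mulrDl -!mulrA -!(ExZ _ (g x _)).
congr (_ + _); (congr (_ * _); apply: eq_Ex => E sE; rewrite big_setU1 //=).
  rewrite !inE eqxx; congr (_ * _); apply: eq_bigr => e eD; rewrite !inE.
  by case: eqP => // ex; rewrite -ex eD in xD.
by rewrite (contraNF (subsetP sE x) xD).
Qed.

Hypothesis p01 : 0 <= p <= 1.

Lemma Ex_le D f g : (forall E, E \subset D -> f E <= g E) -> Ex D f <= Ex D g.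
Proof.
case/andP: p01 => p0 p1 fg; apply: ler_sum => E; rewrite inE => /fg fgE.
by apply: ler_wpM2l => //; apply: mulr_ge0; apply: exprn_ge0 => //; rewrite subr_ge0.
Qed.

Lemma Ex_ge0 D f : (forall E, E \subset D -> 0 <= f E) -> 0 <= Ex D f.
Proof. by move=> f0; rewrite -[leLHS](Ex_cst D); exact: Ex_le. Qed.

(** The probabilistic method: if [f] exceeded [a] on each of the finitely many subsets, so would its
    minimum [m], hence its mean. *)
Lemma Ex_exists D f (a : R) : Ex D f <= a -> exists2 E : {set T}, E \subset D & f E <= a.
Proof.
move=> fa; case: (boolP [exists E in powerset D, f E <= a]) => [/exists_inP[E]|].
  by rewrite inE; exists E.
rewrite negb_exists_in => /forall_inP nf.
have lt_af E : E \subset D -> a < f E.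
  by move=> sE; rewrite ltNge; apply: nf; rewrite inE.
pose m := \big[Num.min/f set0]_(E in powerset D) f E.
have le_m E : E \subset D -> m <= f E.
  by move=> ED; apply: bigmin_le_cond; rewrite inE.
have lt_am : a < m.
  by apply: lt_bigmin => [|E]; [exact/lt_af/sub0set | rewrite inE; exact: lt_af].
have : m <= Ex D f by rewrite -[leLHS](Ex_cst D); exact: Ex_le.
by move=> /(lt_le_trans lt_am) /lt_le_trans /(_ fa); rewrite ltxx.
Qed.

Lemma Ex_sqr_center D f b :
  Ex D (fun E => (f E - b) ^+ 2) =
  Ex D (fun E => (f E - Ex D f) ^+ 2) + (Ex D f - b) ^+ 2.
Proof.
set m := Ex D f.
transitivity (Ex D (fun E => (f E - m) ^+ 2 + (2 * (m - b) * (f E - m) + (m - b) ^+ 2))).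
  by apply: eq_Ex => E _; ring.
by rewrite ExD ExD ExZ ExD !Ex_cst -/m; ring.
Qed.

(** Exchanging [E] and [E'] makes the bound two-sided. In vertex exposure the block at [k] holds the
    pairs joining vertex [k] to smaller ones. *)
Definition block_lipschitz (D : nat -> {set T}) m f :=
  forall k E E', (k < m)%N ->
    E :\: (D k.+1 :\: D k) = E' :\: (D k.+1 :\: D k) -> f E <= f E' + 1.

(* Efron-Stein bound, conditioning successively on the blocks [D k.+1 :\: D k]. *)
Lemma block_variance (D : nat -> {set T}) m f :
  D 0%N = set0 -> (forall k, D k \subset D k.+1) -> block_lipschitz D m f ->
  Ex (D m) (fun E => (f E - Ex (D m) f) ^+ 2) <= m%:R.
Proof.
move=> D0 DS; elim: m f => [|m IH] f Lf.
  by rewrite D0 !Ex_set0 subrr expr0n.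
pose B := D m.+1 :\: D m.
have DB : D m.+1 = D m :|: B by rewrite /B -[LHS](setID _ (D m)) (setIidPr (DS m)).
have dB : [disjoint D m & B].
  by rewrite -setI_eq0; apply/eqP/setP=> x; rewrite !inE; case: (x \in D m).
(* [g] is the conditional expectation of [f] given the part of the set inside [D m]. *)
pose g A := Ex B (fun b => f (A :|: b)).
have Lg : block_lipschitz D m g.
  move=> k E E' km eE; rewrite /g -[1](Ex_cst B) -ExD; apply: Ex_le => b _.
  by apply: (Lf k); [exact: ltnW | rewrite !setDUl eE].
have eg : Ex (D m.+1) f = Ex (D m) g by rewrite DB Ex_setU.
rewrite eg DB Ex_setU // -natr1.
rewrite (@eq_Ex _ _ (fun A => Ex B (fun b => (f (A :|: b) - g A) ^+ 2)
   + (g A - Ex (D m) g) ^+ 2)); last by move=> A _; exact: Ex_sqr_center.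
rewrite ExD addrC lerD ?IH //.
(* What remains is the mean conditional variance; over the last block [f] stays within 1 of its
   conditional mean. *)
rewrite -[leRHS](Ex_cst (D m)); apply: Ex_le => A _.
rewrite -[leRHS](Ex_cst B); apply: Ex_le => b sb.
have Lb (b1 b2 : {set T}) : b1 \subset B -> b2 \subset B -> f (A :|: b1) <= f (A :|: b2) + 1.
  move=> s1 s2; apply: (Lf m) => //; rewrite !setDUl -/B.
  by move: s1 s2; rewrite -!setD_eq0 => /eqP -> /eqP ->.
rewrite -[leRHS](expr1n _ 2) -[leLHS]real_normK ?num_real // lerXn2r ?nnegrE //.
rewrite ler_distlC; apply/andP; split.
- rewrite lerBlDr -[1 in leRHS](Ex_cst B) -(Ex_cst B (f _)) -ExD.
  by apply: Ex_le => b' sb'; exact: Lb.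
- rewrite -(Ex_cst B (f _ + 1)).
  by apply: Ex_le => b' sb'; exact: Lb.
Qed.

End RandomSubset.

(** * Gram matrices and vector colorings *)

Section Gram.
Variable R : realType.

(** Positive semidefiniteness. The free width [N] makes sums immediate; [gram_square] returns to
    vectors in dimension [n]. *)
Definition gram n (M : 'M[R]_n) := exists N (W : 'M[R]_(n, N)), M = W *m W^T.

(* One Gram-Schmidt step on the first row; [u = 0] when that row vanishes, since [0^-1 = 0]. *)
Lemma gram_square n (M : 'M[R]_n) : gram M -> exists V : 'M[R]_n, M = V *m V^T.
Proof.
case=> N [W ->] {M}; elim: n N W => [|n IH] N W.
  by exists 0; apply/matrixP => -[].
pose w : 'rV[R]_N := usubmx (W : 'M[R]_(1 + n, N)).
pose W1 : 'M[R]_(n, N) := dsubmx (W : 'M[R]_(1 + n, N)).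
pose s := (w *m w^T) 0 0; pose al := Num.sqrt s; pose u := al^-1 *: w.
have s_ge0 : 0 <= s.
  by rewrite /s mxE; apply: sumr_ge0 => j _; rewrite !mxE -expr2 sqr_ge0.
have al2 : al * al = s by rewrite -expr2 sqr_sqrtr.
have wu : w = al *: u.
  have [al0|al0] := eqVneq al 0; last by rewrite /u scalerA divff // scale1r.
  rewrite al0 scale0r; apply/rowP => j; rewrite [RHS]mxE.
  have : s = 0 by rewrite -al2 al0 mul0r.
  rewrite /s mxE => /eqP; rewrite psumr_eq0; last first.
    by move=> i _; rewrite !mxE -expr2 sqr_ge0.
  move=> /allP /(_ j); rewrite mem_index_enum => /(_ isT) /=.
  by rewrite !mxE -expr2 sqrf_eq0 => /eqP.
pose b := W1 *m u^T; pose W2 := W1 - b *m u.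
have [V' eV] := IH _ W2.
have buu : b *m (u *m u^T) = b.
  have [al0|al0] := eqVneq al 0.
    by rewrite /b /u al0 invr0 scale0r trmx0 !mulmx0.
  suff -> : u *m u^T = 1%:M by rewrite mulmx1.
  apply/matrixP => i j; rewrite !ord1 /u linearZ /= -scalemxAl -scalemxAr scalerA.
  by rewrite mxE -/s -al2 mxE -invfM mulVf // mulf_neq0.
(* A Cholesky-like factor: the first row is its norm on a new coordinate; the others carry their
   component [b] along [u] and a factor for the part orthogonal to [u]. *)
exists (block_mx al%:M 0 b V').
transitivity (col_mx w W1 *m (col_mx w W1)^T); first by rewrite vsubmxK.
transitivity (block_mx al%:M 0 b V' *m (block_mx al%:M 0 b V')^T) => [|//].
rewrite tr_col_mx mul_col_row tr_block_mx mulmx_block trmx0 tr_scalar_mx.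
rewrite !mulmx0 !mul0mx !addr0 -eV.
have w2 : w *m w^T = al%:M *m al%:M.
  by apply/matrixP => i j; rewrite !ord1 -/s -al2 -scalar_mxM mxE eqxx mulr1n.
have bE : W1 *m w^T = b *m al%:M by rewrite {1}wu linearZ /= -scalemxAr mul_mx_scalar.
have bE' : w *m W1^T = al%:M *m b^T.
  by apply: trmx_inj; rewrite !trmx_mul !trmxK bE tr_scalar_mx.
have dE : W1 *m W1^T = b *m b^T + W2 *m W2^T.
  have ub : u *m W1^T = b^T by rewrite /b trmx_mul trmxK.
  have W2u : W2 *m u^T = 0 by rewrite /W2 mulmxBl -mulmxA buu subrr.
  have -> : W2 *m W2^T = W2 *m W1^T - W2 *m u^T *m b^T.
    by rewrite -mulmxA -trmx_mul -mulmxBr /W2 linearB.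
  by rewrite W2u mul0mx subr0 {1}/W2 mulmxBl -(mulmxA b u) ub addrC subrK.
by rewrite w2 bE bE' dE.
Qed.

Lemma gramD n (M1 M2 : 'M[R]_n) : gram M1 -> gram M2 -> gram (M1 + M2).
Proof.
move=> [N1 [W1 ->]] [N2 [W2 ->]]; exists (N1 + N2)%N, (row_mx W1 W2).
by rewrite tr_row_mx mul_row_col.
Qed.

Lemma gramZ n a (M : 'M[R]_n) : 0 <= a -> gram M -> gram (a *: M).
Proof.
move=> a0 [N [W ->]]; exists N, (Num.sqrt a *: W).
by rewrite linearZ /= -scalemxAl -scalemxAr scalerA -expr2 sqr_sqrtr.
Qed.

Lemma gram_pull m n (f : 'I_n -> 'I_m) (a : 'I_n -> R) (M : 'M[R]_m) :
  gram M -> gram (\matrix_(i, j) (a i * a j * M (f i) (f j))).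
Proof.
move=> [N [W ->]]; exists N, (\matrix_(i, j) (a i * W (f i) j)).
apply/matrixP => i j; rewrite !mxE big_distrr /=; apply: eq_bigr => k _.
by rewrite !mxE; ring.
Qed.

Lemma gram1 n : gram (1%:M : 'M[R]_n).
Proof. by exists n, 1%:M; rewrite trmx1 mulmx1. Qed.

Lemma gram_rank1 n (a : 'I_n -> R) : gram (\matrix_(i, j) (a i * a j)).
Proof.
exists 1%N, (\col_i a i); apply/matrixP => i j.
by rewrite !mxE big_ord1 !mxE.
Qed.

(** The orthogonal projection off the all-ones vector is symmetric and idempotent, hence its own
    factor; rescaled, it is the Gram matrix of a regular simplex. *)
Lemma gram_simplex K :
  gram (\matrix_(i < K.+1, j < K.+1) ((i == j)%:R - K.+1%:R^-1 : R)).
Proof.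
exists K.+1, (\matrix_(i, j) ((i == j)%:R - K.+1%:R^-1)); apply/matrixP => i j.
rewrite !mxE.
under eq_bigr => k _ do rewrite !mxE mulrBl !mulrBr.
rewrite !big_split /= !sumrN big_split /= sumrN sumr_const card_ord.
rewrite (bigD1 i) //= eqxx mul1r big1 ?addr0; last first.
  by move=> k ki; rewrite eq_sym (negbTE ki) mul0r.
rewrite (bigD1 i) //= eqxx mul1r big1 ?addr0; last first.
  by move=> k ki; rewrite eq_sym (negbTE ki) mul0r.
rewrite (bigD1 j) //= eqxx mulr1 big1 ?addr0; last first.
  by move=> k kj; rewrite eq_sym (negbTE kj) mulr0.
rewrite -mulrnAr -[_^-1 *+ _]mulr_natr mulVf ?pnatr_eq0 // eq_sym; ring.
Qed.

End Gram.

Section Coloring.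
Variable R : realType.
Implicit Types (k x c : R) (rel : bool -> R -> R -> Prop).

(* [rel b x c] constrains the inner product [x] of two distinct vertices, [b] telling whether they
   are adjacent, against [c = -1/(k-1)]; the three kinds of vector coloring differ only by [rel]. *)
Definition coloring_rel rel :=
  [/\ forall b c, rel b c c,
      forall b a d x c, 0 <= a -> rel b x c -> rel b (a * x + d) (a * c + d),
      forall x c, c <= x -> rel false x c
    & forall x c, rel true x c -> x <= c].

Definition colorable rel n (E : {set {set 'I_n}}) k :=
  exists M : 'M[R]_n, [/\ gram M, forall i, M i i = 1 &
    forall i j, i != j -> rel ([set i; j] \in E) (M i j) (- (k - 1)^-1)].

Definition chrom rel n (E : {set {set 'I_n}}) : R :=
  inf [set k : R | 1 < k /\ colorable rel E k]%classic.

Variable rel : bool -> R -> R -> Prop.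
Hypothesis relP : coloring_rel rel.

(** Averaging with orthonormal vectors multiplies all off-diagonal entries by [a], chosen to take
    -1/(k-1) to -1/(k'-1). *)
Lemma colorable_mono n (E : {set {set 'I_n}}) k k' :
  1 < k -> k <= k' -> colorable rel E k -> colorable rel E k'.
Proof.
move=> k1 kk' [M [gM dM rM]]; have [_ affine _ _] := relP.
pose a := (k - 1) / (k' - 1).
have k'0 : k' - 1 != 0 by lra.
have a01 : 0 <= a <= 1.
  by rewrite /a divr_ge0 ?ler_pdivrMr /=; lra.
exists (a *: M + (1 - a) *: 1%:M); split.
- by apply: gramD; apply: gramZ => //; [lra | lra | exact: gram1].
- by move=> i; rewrite !mxE dM eqxx mulr1n; ring.
- move=> i j ij; rewrite !mxE (negbTE ij) mulr0n mulr0.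
  have -> : - (k' - 1)^-1 = a * - (k - 1)^-1 + 0.
    by rewrite /a; field; rewrite k'0; lra.
  by apply: affine; [lra | exact: rM].
Qed.

Lemma colorable_complete n (E : {set {set 'I_n}}) :
  (1 < n)%N -> colorable rel E n%:R.
Proof.
case: n E => // n E n1; have [refl _ _ _] := relP.
have n0 : (n%:R : R) != 0 by rewrite pnatr_eq0 -lt0n.
exists ((n.+1%:R / n%:R) *: (\matrix_(i, j) ((i == j)%:R - n.+1%:R^-1))).
have nS : (n.+1%:R : R) = n%:R + 1 by rewrite natr1.
have nS0 : (n%:R + 1 : R) != 0 by rewrite natr1 pnatr_eq0.
split.
- by apply: gramZ; [rewrite divr_ge0 | exact: gram_simplex].
- by move=> i; rewrite !mxE eqxx nS mulr1n; field; rewrite n0 nS0.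
- move=> i j /negbTE ij; rewrite !mxE ij.
  suff -> : n.+1%:R / n%:R * (0%:R - n.+1%:R^-1) = - (n.+1%:R - 1)^-1 :> R by [].
  by rewrite nS mulr0n addrK; field; rewrite n0 nS0.
Qed.

(** The vertices of a regular triangle have inner products -1/2. Mixing them, with weight [th], with
    orthonormal vectors raises this to -1/(k-1); [3 <= k] ensures [th <= 1]. *)
Lemma gram_three_coloring n (c : 'I_n -> 'I_3) k : 3 <= k ->
  exists Y : 'M[R]_n, [/\ gram Y, forall i, Y i i = 1 &
    forall i j, i != j ->
      (c i != c j -> Y i j = - (k - 1)^-1) /\ - (k - 1)^-1 <= Y i j].
Proof.
move=> k3; pose th := 2 / (k - 1).
have kinv : 0 < (k - 1)^-1 by rewrite invr_gt0; lra.
have k0 : k - 1 != 0 by lra.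
have th01 : 0 <= th <= 1.
  by rewrite /th divr_ge0 ?ler_pdivrMr /=; lra.
have gS := gram_pull c (fun=> 1) (gram_simplex R 2).
(* The factor 3/2 normalizes the diagonal entries 2/3 of the simplex projection. *)
exists ((th * (3 / 2)) *: (\matrix_(i, j) (1 * 1 *
  (\matrix_(i < 3, j < 3) ((i == j)%:R - 3%:R^-1)) (c i) (c j))) + (1 - th) *: 1%:M).
split.
- apply: gramD; apply: gramZ => //; [by rewrite mulr_ge0 //; lra | lra | exact: gram1].
- by move=> i; rewrite !mxE !eqxx !mulr1n; field.
- move=> i j ij; rewrite !mxE (negbTE ij) mulr0n.
  have [cc|cc] := eqVneq (c i) (c j); split=> //.
  + have -> : th * (3 / 2) * (1 * 1 * (true%:R - 3^-1)) + (1 - th) * 0 = th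
      by rewrite mulr1n; field.
    lra.
  + by move=> _; rewrite mulr0n /th; field.
  + by rewrite le_eqVlt; apply/orP; left; apply/eqP; rewrite mulr0n /th; field.
Qed.

(* The neighbours of [U] all receive one new vector [z]; every other vector is tilted to have inner
   product [-1/k] with [z], using the given coloring outside [U] and, in orthogonal coordinates, a
   3-coloring inside [U]. *)
Lemma colorable_merge n (E E' : {set {set 'I_n}}) (U : {set 'I_n}) (c : 'I_n -> 'I_3) k :
  3 <= k -> colorable rel E' k ->
  (forall i j, i \notin U -> j \notin U -> ([set i; j] \in E) = ([set i; j] \in E')) ->
  (forall i j, i \in U -> j \in U -> i != j -> [set i; j] \in E -> c i != c j) ->
  (forall i j a b, i \notin U -> j \notin U -> a \in U -> b \in U -> i != j ->
     [set i; a] \in E -> [set j; b] \in E -> [set i; j] \notin E) ->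
  colorable rel E (k + 1).
Proof.
move=> k3 [M [gM dM rM]] EE' cU indep.
have [Y [gY dY rY]] := gram_three_coloring c k3.
have [refl affine noedge _] := relP.
pose I := [set i | (i \notin U) && [exists a in U, [set i; a] \in E]].
pose a i : R := if i \in I then 1 else - k^-1.
pose r i : R := ((i \notin U) && (i \notin I))%:R.
pose u i : R := (i \in U)%:R.
have kV : 0 < k^-1 <= 3^-1.
  by rewrite invr_gt0 lef_pV2 ?posrE; lra.
have kkV : k * k^-1 = 1 by rewrite divff; lra.
(* Beside the coordinate -1/k along [z], squared length [s] is left. Scaling by [s] takes -1/(k-1)
   to -1/k - 1/k^2, and the product of the tilts adds 1/k^2 back. *)
pose s := 1 - k^-1 * k^-1.
have s0 : 0 <= s by rewrite /s; nra.
have k10 : k - 1 != 0 by lra.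
have k0 : k != 0 by lra.
have sE : - k^-1 = s * - (k - 1)^-1 + k^-1 * k^-1.
  by rewrite /s; field; rewrite k0.
have IU i : i \in I -> i \in U = false by rewrite inE => /andP[/negbTE].
exists (\matrix_(i, j) (a i * a j) + s *: (\matrix_(i, j) (r i * r j * M i j) +
   \matrix_(i, j) (u i * u j * Y i j))); split.
- apply: gramD; first exact: gram_rank1.
  by apply: gramZ => //; apply: gramD;
    [exact: (gram_pull id r gM) | exact: (gram_pull id u gY)].
- move=> i; rewrite !mxE dM dY /a /r /u.
  case iI: (i \in I) => /=; first by rewrite (IU i iI) /=; ring.
  by case: (i \in U) => /=; rewrite /s; ring.
move=> i j ij; rewrite !mxE addrK.
have edgeU (x y : 'I_n) : x \in U -> y \notin U -> y \notin I -> [set x; y] \in E = false.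
  move=> xU yU; rewrite inE yU /= negb_exists_in => /forall_inP /(_ x xU).
  by rewrite setUC => /negbTE.
rewrite /a /r /u; case iI: (i \in I); case jI: (j \in I) => /=.
- rewrite (IU i iI) (IU j jI) /= !mul0r addr0 mulr0 addr0.
  (* Both vertices carry [z], with inner product 1, so they must be non-adjacent: this is
     [indep]. *)
  have -> : [set i; j] \in E = false.
    move: iI jI; rewrite !inE => /andP[iU /exists_inP[x xU ix]] /andP[jU /exists_inP[y yU jy]].
    by apply/negbTE/(indep i j x y).
  by apply: noedge; lra.
- rewrite (IU i iI) /= !(andbF, mulr0, mul0r, addr0) mul1r; exact: refl.
- rewrite (IU j jI) /= !(andbF, mulr0, mul0r, addr0) mulr1; exact: refl.
- have -> : - k^-1 * - k^-1 = k^-1 * k^-1 by ring.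
  rewrite !andbT; case iU: (i \in U); case jU: (j \in U) => /=.
  + rewrite !mul0r add0r !mul1r addrC sE.
    have [eY geY] := rY i j ij.
    case ijE: (_ \in E); first by rewrite eY; [exact: refl | exact: cU].
    by apply: noedge; rewrite lerD2r ler_wpM2l.
  + rewrite !(mul0r, mulr0, addr0, add0r) edgeU ?jU ?jI //; apply: noedge; nra.
  + rewrite !(mul0r, mulr0, addr0, add0r) setUC edgeU ?iU ?iI //; apply: noedge; nra.
  + rewrite !mul0r addr0 !mul1r addrC sE EE' ?iU ?jU //.
    by apply: affine => //; exact: rM.
Qed.

Lemma chrom_set_lb n (E : {set {set 'I_n}}) :
  has_lbound [set k : R | 1 < k /\ colorable rel E k]%classic.
Proof. by exists 1 => k [/ltW]. Qed.

Lemma chrom_set_inf n (E : {set {set 'I_n}}) : (1 < n)%N ->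
  has_inf [set k : R | 1 < k /\ colorable rel E k]%classic.
Proof.
move=> n1; split; last exact: chrom_set_lb.
by exists n%:R; split; [rewrite (ltr_nat _ 1) | exact: colorable_complete].
Qed.

Lemma chrom_lt n (E : {set {set 'I_n}}) k : (1 < n)%N ->
  chrom rel E < k -> exists2 k', k' < k & 1 < k' /\ colorable rel E k'.
Proof. by move=> n1 /(inf_lt (chrom_set_inf E n1).1) [k' kP ltk]; exists k'. Qed.

(** Merging is applied at [u + e] for every [e > 0], where a coloring of [E'] exists whether or not
    the infimum is attained. *)
Lemma chrom_merge n (E E' : {set {set 'I_n}}) (U : {set 'I_n}) (c : 'I_n -> 'I_3) u :
  (1 < n)%N -> 3 <= u -> chrom rel E' <= u ->
  (forall i j, i \notin U -> j \notin U -> ([set i; j] \in E) = ([set i; j] \in E')) ->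
  (forall i j, i \in U -> j \in U -> i != j -> [set i; j] \in E -> c i != c j) ->
  (forall i j a b, i \notin U -> j \notin U -> a \in U -> b \in U -> i != j ->
     [set i; a] \in E -> [set j; b] \in E -> [set i; j] \notin E) ->
  chrom rel E <= u + 1.
Proof.
move=> n1 u3 E'u EE' cU indep; apply/ler_addgt0Pr => e e0.
have /chrom_lt -/(_ n1) [k ku [k1 colk]] : chrom rel E' < u + e by lra.
apply: inf_lbound; first exact: chrom_set_lb.
split; first lra.
rewrite addrAC; apply: (@colorable_merge _ _ E' U c) => //; first lra.
by apply: colorable_mono colk => //; exact: ltW.
Qed.

End Coloring.

(** * The three vector chromatic numbers as instances *)

Section Instances.
Variable R : realType.

Definition half_rel (b : bool) (x c : R) := b -> x <= c.
Definition bar_rel (b : bool) (x c : R) := b -> x = c.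
Definition rigid_rel (b : bool) (x c : R) := if b then x = c else c <= x.

Lemma half_relP : coloring_rel half_rel.
Proof.
split=> [b c _ //|b a d x c a0 xc /xc h|x c _ //|x c]; last exact.
by rewrite lerD2r ler_wpM2l.
Qed.

Lemma bar_relP : coloring_rel bar_rel.
Proof. by split=> [b c //|b a d x c _ xc /xc -> //|x c _ //|x c ->]. Qed.

Lemma rigid_relP : coloring_rel rigid_rel.
Proof.
split=> [[] c //=|[] a d x c a0 /=|x c //|x c /= -> //]; first by move=> ->.
by move=> h; rewrite lerD2r ler_wpM2l.
Qed.

Lemma colorable_vectors (rel : bool -> R -> R -> Prop) n (E : {set {set 'I_n}}) (k : R) :
  colorable rel E k <-> exists v : 'I_n -> 'rV[R]_n, unit_vectors v /\
    forall i j, i != j -> rel ([set i; j] \in E) (dotv (v i) (v j)) (- (k - 1)^-1).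
Proof.
split=> [[M [/gram_square [V ->] dM rM]]|[v [uv rv]]].
  exists (fun i => row i V).
  have dotE i j : dotv (row i V) (row j V) = (V *m V^T) i j.
    by rewrite /dotv mxE; apply: eq_bigr => l _; rewrite !mxE.
  by split=> [i|i j ij]; rewrite dotE; [exact: dM | exact: rM].
pose V : 'M[R]_n := \matrix_i v i.
have dotE i j : (V *m V^T) i j = dotv (v i) (v j).
  by rewrite /dotv mxE; apply: eq_bigr => l _; rewrite !mxE.
exists (V *m V^T); split=> [|i|i j ij]; first by exists n, V.
  by rewrite dotE uv.
by rewrite dotE; exact: rv.
Qed.

Lemma chrom_eq_inf (rel : bool -> R -> R -> Prop) n (E : {set {set 'I_n}})
    (P : R -> ('I_n -> 'rV[R]_n) -> Prop) :
  (forall k v, P k v <-> unit_vectors v /\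
    forall i j, i != j -> rel ([set i; j] \in E) (dotv (v i) (v j)) (- (k - 1)^-1)) ->
  chrom rel E = inf [set k : R | 1 < k /\ exists v, P k v]%classic.
Proof.
move=> PE; congr inf; apply/seteqP; split=> k [k1].
  by move=> /colorable_vectors [v vP]; split=> //; exists v; apply/PE.
by move=> [v /PE vP]; split=> //; apply/colorable_vectors; exists v.
Qed.

Lemma edge_neq n (E : {set {set 'I_n}}) i j :
  E \subset pairs n -> [set i; j] \in E -> i != j.
Proof. by move=> /subsetP sE /sE; rewrite inE cards2; case: (i != j). Qed.

Lemma theta_half_chrom n (E : {set {set 'I_n}}) :
  E \subset pairs n -> theta_half R E = chrom half_rel E.
Proof.
move=> sE; symmetry; apply: chrom_eq_inf => k v; split=> -[uv rv]; split=> // i j.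
  by move=> _; exact: rv.
by move=> ijE; exact: rv (edge_neq sE ijE) ijE.
Qed.

Lemma theta_bar_chrom n (E : {set {set 'I_n}}) :
  E \subset pairs n -> theta_bar R E = chrom bar_rel E.
Proof.
move=> sE; symmetry; apply: chrom_eq_inf => k v; split=> -[uv rv]; split=> // i j.
  by move=> _; exact: rv.
by move=> ijE; exact: rv (edge_neq sE ijE) ijE.
Qed.

Lemma theta_2_chrom n (E : {set {set 'I_n}}) :
  E \subset pairs n -> theta_2 R E = chrom rigid_rel E.
Proof.
move=> sE; symmetry; apply: chrom_eq_inf => k v; split=> -[uv rv]; split=> //.
  by move=> i j ij; case: rv => re rn; rewrite /rigid_rel; case: ifP => [/re//|/negbT]; exact: rn.
split=> i j.
  by move=> ijE; have := rv i j (edge_neq sE ijE); rewrite ijE.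
by move=> ij /negbTE ijE; have := rv i j ij; rewrite ijE.
Qed.

End Instances.

(** * Sparse graphs *)

Section SparseGraphs.
Variable n : nat.
Implicit Types (E : {set {set 'I_n}}) (S T U : {set 'I_n}).
Local Open Scope nat_scope.

Definition edges_in E U := [set e in E | e \subset U].

(** With denominators cleared: fewer than 3/2 - 1/(2M) edges per vertex. The gap 1/(2M) is what
    bounds the set built in [sparse_closure]. *)
Definition sparse M L E := forall T, T != set0 -> #|T| <= L ->
  2 * M * #|edges_in E T| < (3 * M - 1) * #|T|.

Lemma handshake E U : E \subset pairs n ->
  \sum_(v in U) #|[set e in edges_in E U | v \in e]| = 2 * #|edges_in E U|.
Proof.
move=> sE.
under eq_bigr => v _ do rewrite -sum1dep_card big_mkcondr /=.
rewrite exchange_big /= mulnC -sum_nat_const; apply: eq_bigr => e.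
rewrite inE => /andP[eE eU].
rewrite -big_mkcondr /= sum1dep_card.
have /eqP <- : #|e| == 2 by have := subsetP sE e eE; rewrite inE.
apply: eq_card => v; rewrite !inE.
by apply/andP/idP => [[]//|ve]; rewrite (subsetP eU).
Qed.

(** The average degree inside [U] is below 3, so some vertex has at most two neighbours there; the
    rest is colored by induction, and one of the three colors stays free. *)
Lemma three_colorable E U : E \subset pairs n ->
  (forall T, T \subset U -> T != set0 -> 2 * #|edges_in E T| < 3 * #|T|) ->
  exists c : 'I_n -> 'I_3, forall i j, i \in U -> j \in U -> i != j ->
    [set i; j] \in E -> c i != c j.
Proof.
move=> sE; have [m] := ubnP #|U|; elim: m U => // m IH U ltU spU.
have [->|U0] := eqVneq U set0; first by exists (fun=> ord0) => i j; rewrite inE.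
have [v vU degv] : exists2 v, v \in U & #|[set e in edges_in E U | v \in e]| <= 2.
  apply/exists_inP; apply: contraT; rewrite negb_exists_in => /forall_inP degU.
  have := spU U (subxx _) U0; rewrite -handshake // ltnNge => /negP[].
  by rewrite mulnC -sum_nat_const; apply: leq_sum => v /degU; rewrite -ltnNge.
have [|T sT T0|c0 c0P] := IH (U :\ v).
- by rewrite (cardsD1 v) vU in ltU.
- by apply: spU T0; apply: subset_trans sT (subsetDl _ _).
(* The endpoint of [e] other than [v]; the default is never reached when [e] is an edge at [v]. *)
pose other e := odflt v [pick w in e :\ v].
have otherE w : w != v -> other [set v; w] = w.
  move=> wv; rewrite /other; case: pickP => [w'|/(_ w)]; last by rewrite !inE wv eqxx orbT.
  by rewrite !inE => /andP[/negbTE -> /eqP].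
pose F := [set c0 (other e) | e in [set e in edges_in E U | v \in e]].
have [col colF] : exists col, col \notin F.
  apply/existsP; apply: contraT; rewrite negb_exists => /forallP allF.
  have : #|F| <= 2 by apply: leq_trans degv; exact: leq_imset_card.
  suff -> : F = setT by rewrite cardsT card_ord.
  by apply/setP => x; rewrite inE; have := allF x; rewrite negbK.
have colE w : w \in U -> w != v -> [set v; w] \in E -> c0 w != col.
  move=> wU wv vwE; apply: contraNneq colF => <-; apply/imsetP; exists [set v; w].
    rewrite !inE vwE eqxx /= andbT; apply/subsetP => x.
    by rewrite !inE => /orP[]/eqP ->.
  by rewrite otherE.
exists (fun i => if i == v then col else c0 i) => i j iU jU ij ijE.
have [iv|iv] := eqVneq i v; have [jv|jv] := eqVneq j v.
- by rewrite iv jv eqxx in ij.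
- by rewrite eq_sym colE // -iv.
- by rewrite colE // -jv setUC.
- by apply: c0P; rewrite // !inE ?iv ?jv.
Qed.

(* Absorbing two adjacent outside vertices, each with a neighbour in [U], adds 2 vertices and at
   least 3 edges; sparsity bounds how often this can be done starting from [S]. *)
Lemma sparse_closure E S M L : E \subset pairs n -> 0 < M -> sparse M L E ->
  3 * M * #|S| + 2 <= L ->
  exists U, [/\ S \subset U, #|U| <= L & forall i j a b, i \notin U -> j \notin U ->
    a \in U -> b \in U -> i != j ->
    [set i; a] \in E -> [set j; b] \in E -> [set i; j] \notin E].
Proof.
move=> sE M0 spE SL.
have arith u e s : 3 * u <= 2 * e + 3 * s -> 2 * M * e < (3 * M - 1) * u -> u < 3 * M * s.
  move=> h1; have: M * (3 * u) <= M * (2 * e + 3 * s) by rewrite leq_mul2l h1 orbT.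
  by rewrite mulnBl; clear; lia.
(* The edge count in [P] survives absorbing 2 vertices and 3 edges, since 3 * 2 = 2 * 3. A largest
   set satisfying [P] is taken. *)
pose P U := [&& S \subset U, 3 * #|U| <= 2 * #|edges_in E U| + 3 * #|S| & #|U| <= L].
have PS : P S.
  rewrite /P subxx leq_addl /=; apply: leq_trans SL; apply: leq_trans (leq_addr _ _).
  by rewrite leq_pmull // muln_gt0.
have [U /and3P[SU dU UL] maxU] := arg_maxnP (fun U => #|U|) PS.
exists U; split=> // i j a b iU jU aU bU ij iaE jbE; apply/negP => ijE.
(* Sparsity against the edge count in [P] bounds [U], leaving room within [L] for two more
   vertices. *)
have ltU : #|U| < 3 * M * #|S|.
  have U0 : U != set0 by apply/set0Pn; exists a.
  exact: arith dU (spE U U0 UL).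
pose U' := i |: (j |: U).
have cU' : #|U'| = #|U| + 2.
  by rewrite /U' !cardsU1 !inE negb_or ij iU jU addnA addnC.
have ai : a != i by apply: contraNneq iU => <-.
have bj : b != j by apply: contraNneq jU => <-.
have aj : a != j by apply: contraNneq jU => <-.
have bi : b != i by apply: contraNneq iU => <-.
have cE : #|edges_in E U| + 3 <= #|edges_in E U'|.
  pose D := [set i; j] |: ([set i; a] |: ([set j; b] |: edges_in E U)).
  have notin x y : x \notin U -> [set x; y] \notin edges_in E U.
    move=> xU; rewrite inE negb_and; apply/orP; right; apply: contra xU => /subsetP; apply.
    by rewrite !inE eqxx.
  have neq (A B : {set 'I_n}) x : x \in A -> x \notin B -> A != B.
    by move=> xA xB; apply: contraNneq xB => <-.
  have -> : #|edges_in E U| + 3 = #|D|.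
    rewrite /D !cardsU1 [_ \in _ |: _]in_setU1 [[set i; j] \in _ |: _]in_setU1.
    rewrite !in_setU1 !negb_or !notin //=.
    rewrite (@neq [set i; j] [set i; a] j) ?inE ?eqxx ?orbT //; last first.
      by rewrite negb_or eq_sym ij eq_sym aj.
    rewrite (@neq [set i; j] [set j; b] i) ?inE ?eqxx ?orbT //; last first.
      by rewrite negb_or ij eq_sym bi.
    rewrite (@neq [set i; a] [set j; b] i) ?inE ?eqxx ?orbT //; last first.
      by rewrite negb_or ij eq_sym bi.
    by rewrite addn3.
  apply/subset_leq_card/subsetP => e; rewrite !inE.
  have sub x y : x \in U' -> y \in U' -> [set x; y] \subset U'.
    by move=> xU yU; apply/subsetP => z; rewrite !inE => /orP[]/eqP->; rewrite -?in_setU1.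
  have [iU' jU'] : i \in U' /\ j \in U' by rewrite !inE !eqxx orbT.
  have UU' x : x \in U -> x \in U' by rewrite !inE => ->; rewrite !orbT.
  case/or4P => [/eqP ->|/eqP ->|/eqP ->|/andP[-> eU]].
  - by rewrite ijE sub.
  - by rewrite iaE sub // UU'.
  - by rewrite jbE sub // UU'.
  - by apply/subsetP => x /(subsetP eU) /UU'.
have /maxU : P U'.
  rewrite /P cU'; apply/and3P; split; [|clear -dU cE; lia|clear -ltU SL; lia].
  by apply: subset_trans SU _; apply/subsetP => x xU; rewrite !inE xU !orbT.
by rewrite cU' addn2 /= ltnNge leqnSn.
Qed.

End SparseGraphs.

(** * Colorings with k < 3 yield large cuts *)

Section Rademacher.
Variables (R : realType) (T : finType).
Implicit Types (D E : {set T}) (v w : T -> R).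

(** Serves twice: as independent fair signs when [E] is random with probability 1/2, and as a cut
    when [E] is a vertex set, the product over an edge being -1 exactly when it is cut. *)
Definition sgn E j : R := (-1) ^+ (j \in E).

Definition rad D v E := \sum_(j in D) sgn E j * v j.

Lemma radU1 x D v E : x \notin D -> E \subset D ->
  rad (x |: D) v (x |: E) = rad D v E - v x /\ rad (x |: D) v E = rad D v E + v x.
Proof.
move=> xD sE; have xE : x \in E = false by apply: contraNF xD; exact: (subsetP sE).
rewrite /rad !big_setU1 //= /sgn !inE eqxx xE /=; split.
  rewrite expr1 mulN1r addrC; congr (_ - _); apply: eq_bigr => j jD; rewrite !inE.
  by case: eqP => // jx; rewrite -jx jD in xD.
by rewrite expr0 mul1r addrC.
Qed.

Lemma rad_covariance D v w :
  Ex 2^-1 D (fun E => rad D v E * rad D w E) = \sum_(j in D) v j * w j.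
Proof.
elim/setU1_ind: D => [|x D xD IH]; first by rewrite Ex_set0 /rad !big_set0 mul0r.
rewrite ExU1 // -!ExZ -ExD big_setU1 //= -IH addrC -[v x * w x](Ex_cst (2^-1) D) -ExD.
apply: eq_Ex => E sE; have [-> ->] := radU1 v xD sE; have [-> ->] := radU1 w xD sE.
by field.
Qed.

(** Khinchine's inequality with the Gaussian constant 3. Terms odd in the new sign cancel, and the
    increment 6 v^2 s + v^4 is covered by the growth of 3 s^2. *)
Lemma rad_moment4 D v :
  Ex 2^-1 D (fun E => rad D v E ^+ 4) <= 3 * (\sum_(j in D) v j ^+ 2) ^+ 2.
Proof.
elim/setU1_ind: D => [|x D xD IH].
  by rewrite Ex_set0 /rad !big_set0 expr0n mulr_ge0 // sqr_ge0.
have -> : Ex 2^-1 (x |: D) (fun E => rad (x |: D) v E ^+ 4) =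
    Ex 2^-1 D (fun E => rad D v E ^+ 4) + (6 * v x ^+ 2 * \sum_(j in D) v j ^+ 2 + v x ^+ 4).
  under [X in 6 * _ * X]eq_bigr => j _ do rewrite expr2.
  rewrite -rad_covariance -ExZ -[v x ^+ 4](Ex_cst (2^-1) D) -!ExD ExU1 // -!ExZ -ExD.
  apply: eq_Ex => E sE; have [-> ->] := radU1 v xD sE; by field.
rewrite big_setU1 //=; set s := \sum_(j in D) _ in IH *.
have : 0 <= (v x ^+ 2) ^+ 2 by rewrite sqr_ge0.
rewrite -exprM; move: IH; set a := Ex _ _ _; nra.
Qed.

End Rademacher.

Section CutVector.
Variable R : realType.

Definition clamp (y : R) := Num.max (-4) (Num.min 4 y).

Lemma clampP y :
  [/\ `|clamp y / 4| <= 1, clamp y ^+ 2 <= y ^+ 2 & (y - clamp y) ^+ 2 <= y ^+ 4 / 256].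
Proof.
have sq4 (d : R) : `|d| <= y ^+ 2 / 16 -> d ^+ 2 <= y ^+ 4 / 256.
  move=> hd; have -> : y ^+ 4 / 256 = (y ^+ 2 / 16) ^+ 2 by field.
  by rewrite -(real_normK (num_real d)) lerXn2r // nnegrE ?normr_ge0 // (le_trans _ hd).
have bnd (c : R) : -4 <= c <= 4 -> `|c / 4| <= 1.
  by move=> h; rewrite ler_norml; lra.
rewrite /clamp minEle maxEle; case: (leP 4 y) => y4.
  have -> : -4 <= 4 :> R by lra.
  (* Since (y - 8)^2 >= 0, the excess y - 4 is at most y^2 / 16. *)
  have h := sqr_ge0 (y - 8); rewrite expr2 in h.
  by split; [apply: bnd; lra | nra | apply: sq4; rewrite ger0_norm ?expr2; lra].
case: (leP (-4) y) => y4'.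
  split; [by apply: bnd; lra | nra | by apply: sq4; rewrite subrr normr0; nra].
have h := sqr_ge0 (y + 8); rewrite expr2 in h.
by split; [apply: bnd; lra | nra | apply: sq4; rewrite ler0_norm ?expr2; lra].
Qed.

(** With x, y the clamped values, ab - xy = (a - x) b + x (b - y); weighted AM-GM on each product
    leaves the errors to fourth and second moments. *)
Lemma clampM_le a b :
  clamp a * clamp b <= a * b + (a ^+ 4 + b ^+ 4) / 64 + (a ^+ 2 + b ^+ 2) / 16.
Proof.
have [_ ca da] := clampP a; have [_ cb db] := clampP b.
move: (clamp a) (clamp b) ca da cb db => x y ca da cb db.
have h1 : 0 <= (2 * (a - x) + b / 4) ^+ 2 by rewrite sqr_ge0.
have h2 : 0 <= (2 * (b - y) + x / 4) ^+ 2 by rewrite sqr_ge0.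
by move: h1 h2; rewrite !expr2 in ca cb da db *; lra.
Qed.

(** The sum is affine in each coordinate, so the coordinates can be moved one at a time to an end of
    [-1, 1] without increasing it. *)
Lemma round_multilinear n (E : {set {set 'I_n}}) (z : 'I_n -> R) :
  (forall i, `|z i| <= 1) -> exists s : {set 'I_n},
  \sum_(e in E) \prod_(i in e) sgn R s i <= \sum_(e in E) \prod_(i in e) z i.
Proof.
move=> z1; pose F (z : 'I_n -> R) := \sum_(e in E) \prod_(i in e) z i.
pose upd (y : 'I_n -> R) x t i := if i == x then t else y i.
have [z' [_ sz' Fz']] : exists z', [/\ forall i, `|z' i| <= 1,
    forall i, i \in [set: 'I_n] -> z' i = 1 \/ z' i = -1 & F z' <= F z].
  elim/setU1_ind: [set: 'I_n] => [|x D xD [y [y1 yD Fy]]].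
    by exists z; split=> // i; rewrite inE.
  pose A := \sum_(e in E | x \notin e) \prod_(i in e) y i.
  pose B := \sum_(e in E | x \in e) \prod_(i in e | i != x) y i.
  have Fupd t : F (upd y x t) = t * B + A.
    rewrite /F (bigID (fun e : {set 'I_n} => x \in e)) /= big_distrr /=.
    congr (_ + _); apply: eq_bigr => e /andP[_ xe].
      rewrite (bigD1 x) //= {1}/upd eqxx; congr (_ * _).
      by apply: eq_bigr => i /andP[_ /negbTE ix]; rewrite /upd ix.
    by apply: eq_bigr => i ie; rewrite /upd; case: eqP => // ix; rewrite -ix ie in xe.
  have Fy' : F y = y x * B + A.
    rewrite -Fupd; apply: eq_bigr => e _; apply: eq_bigr => i _.
    by rewrite /upd; case: eqP => [->|].
  have [t t1 Ft] : exists2 t : R, t = 1 \/ t = -1 & t * B + A <= F y.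
    rewrite Fy'; have := y1 x; rewrite ler_norml => /andP[lx ux].
    by have [B0|B0] := leP 0 B; [exists (-1); [right|nra] | exists 1; [left|nra]].
  exists (upd y x t); split; last by rewrite Fupd (le_trans Ft).
    move=> i; rewrite /upd; case: eqP => // _.
    by case: t1 => ->; rewrite ?normrN normr1.
  by move=> i; rewrite !inE /upd; case: eqP => //= _ /yD.
exists [set i | z' i != 1]; rewrite (le_trans _ Fz') // /F le_eqVlt; apply/orP; left.
apply/eqP; apply: eq_bigr => e _; apply: eq_bigr => i _; rewrite /sgn inE.
have [|->|->] := sz' i; rewrite ?inE // ?eqxx //.
by have -> : (-1 : R) != 1 by rewrite lt_eqF //; lra.
Qed.

(* Random signs project the vectors to the line with covariances [M i j]; after clamping at 4 and
   rounding, a correlation at most -1/2 on every edge still leaves average -1/64. *)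
Lemma cut_vector n (E : {set {set 'I_n}}) (M : 'M[R]_n) :
  E \subset pairs n -> gram M -> (forall i, M i i = 1) ->
  (forall i j, i != j -> [set i; j] \in E -> M i j <= - 2^-1) ->
  exists s : {set 'I_n}, \sum_(e in E) (\prod_(i in e) sgn R s i + 64^-1) <= 0.
Proof.
move=> sE [N [W MW]] dM eM.
pose Y i := rad [set: 'I_N] (W i).
have covY i j : Ex 2^-1 [set: 'I_N] (fun S => Y i S * Y j S) = M i j.
  rewrite rad_covariance MW mxE; apply: eq_big => [k|k _]; first by rewrite inE.
  by rewrite mxE.
have p01 : 0 <= (2^-1 : R) <= 1 by lra.
have varY i : Ex 2^-1 [set: 'I_N] (fun S => Y i S ^+ 2) = 1.
  by rewrite -[RHS](dM i) -covY; apply: eq_Ex => S _; rewrite expr2.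
have m4Y i : Ex 2^-1 [set: 'I_N] (fun S => Y i S ^+ 4) <= 3.
  apply: le_trans (rad_moment4 _ _) _.
  suff -> : \sum_(j in [set: 'I_N]) W i j ^+ 2 = 1 by rewrite expr1n mulr1.
  rewrite -[RHS](dM i) -covY rad_covariance; apply: eq_bigr => j _; exact: expr2.
pose z S i := clamp (Y i S) / 4.
have zE : Ex 2^-1 [set: 'I_N] (fun S => \sum_(e in E) \prod_(i in e) z S i)
    <= \sum_(e in E) - 64^-1.
  rewrite Ex_sum; apply: ler_sum => e eE.
  have : e \in pairs n by exact: (subsetP sE).
  rewrite inE => /cards2P[i [j [ij eij]]]; rewrite eij in eE *.
  under eq_Ex => S _ do rewrite big_setU1 ?inE //= big_set1.
  have : Ex 2^-1 [set: 'I_N] (fun S => 16 * (z S i * z S j)) <=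
     Ex 2^-1 [set: 'I_N] (fun S => Y i S * Y j S + 64^-1 * (Y i S ^+ 4 + Y j S ^+ 4)
       + 16^-1 * (Y i S ^+ 2 + Y j S ^+ 2)).
    apply: Ex_le => // S _; have := clampM_le (Y i S) (Y j S).
    by rewrite /z; set a := clamp _; set b := clamp _; lra.
  rewrite ExZ !ExD !ExZ !ExD covY !varY.
  (* The bound is -1/2 + 6/64 + 2/16 = -9/32; divided by 16 it is still below -1/64. *)
  have := eM i j ij eE; have := m4Y i; have := m4Y j.
  set a := Ex _ _ _; set b := Ex _ _ _; set c := Ex _ _ _; lra.
have [S _ zS] := Ex_exists p01 zE.
have [s hs] : exists s : {set 'I_n},
    \sum_(e in E) \prod_(i in e) sgn R s i <= \sum_(e in E) \prod_(i in e) z S i.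
  by apply: round_multilinear => i; have [] := clampP (Y i S).
exists s; rewrite big_split /= -[X in _ + X]opprK -sumrN subr_le0.
exact: le_trans hs zS.
Qed.

End CutVector.

Lemma double_sum_pairs (V : nmodType) n (F : {set 'I_n} -> V) :
  \sum_(i < n) \sum_(j < n | j != i) F [set i; j] = (\sum_(e in pairs n) F e) *+ 2.
Proof.
have inner i : \sum_(j < n | j != i) F [set i; j] = \sum_(e in pairs n | i \in e) F e.
  transitivity (\sum_(j in [set~ i]) F [set i; j]).
    by apply: eq_bigl => j; rewrite !inE.
  rewrite -(big_imset F (h := fun j => [set i; j])) /=; last first.
    move=> j k; rewrite !inE => ji ki /setP /(_ j); rewrite !inE eqxx orbT (negbTE ji) /=.
    by move=> /esym /eqP.
  apply: eq_bigl => e; rewrite !inE; apply/imsetP/andP => [[j]|[/cards2P[j [k [jk ->]]]]].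
    rewrite !inE => ji ->; rewrite cards2 (eq_sym i) ji; split=> //.
    by rewrite !inE eqxx.
  rewrite !inE => /orP[/eqP ->|/eqP ->]; [exists k | exists j]; rewrite ?inE //.
    by rewrite eq_sym.
  by rewrite setUC.
under eq_bigr => i _ do rewrite inner big_mkcondr /=.
rewrite exchange_big /= -sumrMnl; apply: eq_bigr => e; rewrite inE => /eqP e2.
by rewrite -big_mkcondr /= sumr_const -e2; congr (_ *+ _).
Qed.

(** * Improbability of large cuts *)

Section LowerBound.
Variable R : realType.

Lemma gnp_probE n (p : R) (P : {set {set 'I_n}} -> bool) :
  gnp_prob p P = Ex p (pairs n) (fun E => (P E)%:R).
Proof.
rewrite /gnp_prob /Ex big_mkcondr; apply: eq_bigr => E _.
by case: (P E); rewrite ?mulr1 ?mulr0.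
Qed.

Lemma card_pairs n : (#|pairs n|%:R : R) * 2 = n%:R * (n%:R - 1).
Proof.
have := double_sum_pairs (fun _ : {set 'I_n} => 1 : R).
rewrite sumr_const -[_ *+ _ *+ 2]mulr_natr => <-.
under eq_bigr => i _.
  rewrite (_ : \sum_(j < n | j != i) 1 = n%:R - 1 :> R); last first.
    by rewrite sumr_const cardC1 card_ord -subn1 natrB // (leq_trans _ (ltn_ord i)).
  over.
by rewrite sumr_const card_ord -[LHS]mulr_natl.
Qed.

Lemma prod_sgn n (e s : {set 'I_n}) :
  \prod_(i in e) sgn R s i = 1 \/ \prod_(i in e) sgn R s i = -1.
Proof.
apply: (big_ind (fun x => x = 1 \/ x = -1)) => [|a b [->|->] [->|->]|i _];
  rewrite ?(mulrN1, mul1r, mulr1, opprK); auto.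
by rewrite /sgn; case: (i \in s); rewrite ?expr1 ?expr0; auto.
Qed.

(** The square of the sum of all signs is [n] plus twice this sum. So a cut of the complete graph
    exceeds half of the edges by a linear amount only. *)
Lemma sum_sgn_pairs n (s : {set 'I_n}) :
  - (n%:R / 2) <= \sum_(e in pairs n) \prod_(i in e) sgn R s i.
Proof.
set x := \sum_(e in pairs n) _.
have sgn2 i : sgn R s i * sgn R s i = 1 by rewrite /sgn -expr2 sqrr_sign.
suff : (\sum_(i < n) sgn R s i) ^+ 2 = n%:R + x * 2.
  by have := sqr_ge0 (\sum_(i < n) sgn R s i) => /[swap] ->; lra.
rewrite mulr_natr -double_sum_pairs expr2 big_distrlr /=.
rewrite -[n in n%:R]card_ord -sumr_const -big_split; apply: eq_bigr => i _ /=.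
rewrite (bigD1 i) //= sgn2; congr (_ + _); apply: eq_bigr => j ji.
by rewrite big_setU1 ?big_set1 // inE eq_sym.
Qed.

(** Multiply by [expR y >= 1 + y]: the product (1 - y + 2y^2)(1 + y) = 1 + y^2 (1 + 2y) is at least
    1. *)
Lemma expRN_le (y : R) : - 2^-1 <= y -> expR (- y) <= 1 - y + 2 * y ^+ 2.
Proof.
move=> hy; rewrite expRN -[leLHS]mul1r ler_pdivrMr ?expR_gt0 //.
have h : (1 - y + 2 * y ^+ 2) * (1 + y) <= (1 - y + 2 * y ^+ 2) * expR y.
  by rewrite ler_wpM2l ?expR_ge1Dx //; rewrite expr2; nra.
apply: le_trans h; have : 0 <= y ^+ 2 * (1 + 2 * y) by rewrite mulr_ge0 ?sqr_ge0 //; lra.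
by rewrite !expr2; lra.
Qed.

(* Chernoff bound with parameter 1/1024. *)
Lemma cut_prob n (p : R) (s : {set 'I_n}) : 0 <= p <= 1 -> (1 < n)%N ->
  Ex p (pairs n) (fun E => (\sum_(e in E) (\prod_(i in e) sgn R s i + 64^-1) <= 0)%R%:R)
    <= expR (p * (n%:R / 2048 - n%:R ^+ 2 / (512 * 1024))).
Proof.
move=> p01 n1; have [t t0 tE] : exists2 t : R, 0 <= t & t = 1024^-1 by exists 1024^-1; lra.
pose y (e : {set 'I_n}) : R := t * (\prod_(i in e) sgn R s i + 64^-1).
have y_bnd (e : {set 'I_n}) : - (500^-1) <= y e <= 500^-1.
  by rewrite /y tE; case: (prod_sgn e s) => ->; lra.
apply: (@le_trans _ _ (Ex p (pairs n) (fun E =>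
    \prod_(e in pairs n) (if e \in E then expR (- y e) else 1)))).
  apply: Ex_le => // E sE.
  have -> : \prod_(e in pairs n) (if e \in E then expR (- y e) else 1) =
            expR (- \sum_(e in E) y e).
    rewrite -big_mkcondr /= -sumrN expR_sum; apply: eq_bigl => e.
    by rewrite andb_idl // => /(subsetP sE).
  have [le0|_] := boolP (\sum_(e in E) (\prod_(i in e) sgn R s i + 64^-1) <= 0);
    last by rewrite expR_ge0.
  apply: le_trans (expR_ge1Dx _); rewrite lerDl oppr_ge0 /y -big_distrr /=.
  exact: mulr_ge0_le0.
rewrite (Ex_prod p (pairs n) (fun e b => if b then expR (- y e) else 1)) /=.
have step (e : {set 'I_n}) : p * expR (- y e) + (1 - p) * 1 <= expR (p * (- y e + 2 * y e ^+ 2)).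
  apply: le_trans (expR_ge1Dx _); have := y_bnd e => ye.
  have h : expR (- y e) <= 1 - y e + 2 * y e ^+ 2 by apply: expRN_le; lra.
  have : p * expR (- y e) <= p * (1 - y e + 2 * y e ^+ 2) by apply: ler_wpM2l; lra.
  lra.
apply: (@le_trans _ _ (\prod_(e in pairs n) expR (p * (- y e + 2 * y e ^+ 2)))).
  apply: ler_prod => e _; rewrite step andbT addr_ge0 ?mulr_ge0 ?expR_ge0 //; lra.
rewrite -expR_sum ler_expR -big_distrr /= ler_wpM2l //; first lra.
(* The drift [t] / 64 equals 2 / (128 * 1024), and the quadratic term consumes at most half of
   it. *)
have : \sum_(e in pairs n) (- y e + 2 * y e ^+ 2) <=
    \sum_(e in pairs n) (- t * \prod_(i in e) sgn R s i - (128 * 1024)^-1).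
  apply: ler_sum => e _; have := y_bnd e => ye.
  have : y e ^+ 2 <= 4 / (1024 * 1024).
    by rewrite /y tE; case: (prod_sgn e s) => ->; lra.
  by rewrite {2}/y tE; lra.
move=> /le_trans; apply; rewrite big_split /= -big_distrr /= sumr_const -mulr_natl.
have := sum_sgn_pairs s; have := card_pairs n; set N : R := #|_|%:R; set x := \sum_(e in _) _.
have : (2 : R) <= n%:R by rewrite ler_nat.
by move=> n2 hN hx; nra.
Qed.

Lemma chrom_lt3 (rel : bool -> R -> R -> Prop) n (E : {set {set 'I_n}}) :
  coloring_rel rel -> (1 < n)%N -> E \subset pairs n -> chrom rel E < 3 ->
  exists s : {set 'I_n}, \sum_(e in E) (\prod_(i in e) sgn R s i + 64^-1) <= 0.
Proof.
move=> relP n1 sE /(chrom_lt relP n1)[k k3 [k1 [M [gM dM rM]]]].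
have [_ _ _ relT] := relP; apply: cut_vector gM dM _ => // i j ij ijE.
have := rM i j ij; rewrite ijE => /relT /le_trans; apply.
by rewrite lerN2 lef_pV2 ?posrE; lra.
Qed.

Lemma chrom_lt3_prob (rel : bool -> R -> R -> Prop) n (p : R) :
  coloring_rel rel -> (1 < n)%N -> 0 <= p <= 1 -> 2048 * 1024 < p * n%:R ->
  Ex p (pairs n) (fun E => (chrom rel E < 3)%R%:R) <= expR (- n%:R).
Proof.
move=> relP n1 p01 pn.
pose B (s : {set 'I_n}) (E : {set {set 'I_n}}) :=
  \sum_(e in E) (\prod_(i in e) sgn R s i + 64^-1) <= 0.
apply: (@le_trans _ _ (Ex p (pairs n) (fun E => \sum_(s : {set 'I_n}) (B s E)%:R))).
  apply: Ex_le => // E sE; have [lt3|_] := boolP (chrom rel E < 3); last by rewrite sumr_ge0.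
  have [s hs] := chrom_lt3 relP n1 sE lt3.
  by rewrite (bigD1 s) //= /B hs lerDl sumr_ge0.
rewrite Ex_sum.
(* As [p <= 1], [n] itself exceeds 2048 * 1024, so the quadratic term dominates and each cut costs
   at most [expR (- 3 * n%:R)], against at most [expR n%:R] cuts. *)
apply: (@le_trans _ _ (\sum_(s : {set 'I_n}) expR (- 3 * n%:R))).
  apply: ler_sum => s _; apply: le_trans (cut_prob s p01 n1) _; rewrite ler_expR.
  by have n2 : (2 : R) <= n%:R; [rewrite ler_nat | nra].
have card_sets : #|{set 'I_n}| = (2 ^ n)%N.
  by rewrite -cardsT -powersetT card_powerset cardsT card_ord.
rewrite sumr_const card_sets -[_ *+ (2 ^ n)]mulr_natl natrX.
have e2 : (2 : R) <= expR 1 by have := expR_ge1Dx (1 : R); lra.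
apply: (@le_trans _ _ (expR n%:R * expR (- 3 * n%:R))).
  apply: ler_wpM2r; first exact: expR_ge0.
  by rewrite -[n%:R in leRHS]mulr1 expRM_natl ?lerXn2r ?nnegrE ?expR_ge0.
by rewrite -expRD ler_expR; have : (0 : R) <= n%:R by []; lra.
Qed.

End LowerBound.

(** * Sparsity of small vertex sets *)

Section Sparsity.
Variable R : realType.

Lemma Ex_subset (T : finType) (p : R) (D F : {set T}) :
  F \subset D -> Ex p D (fun E => (F \subset E)%:R) = p ^+ #|F|.
Proof.
move=> FD; pose g e (b : bool) : R := if e \in F then b%:R else 1.
transitivity (Ex p D (fun E => \prod_(e in D) g e (e \in E))).
  apply: eq_Ex => E _; have [FE|] := boolP (F \subset E).
    rewrite big1 // => e eD; rewrite /g; case: ifP => // eF.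
    by rewrite (subsetP FE).
  move=> /subsetPn[e eF eE]; rewrite (bigD1 e) ?(subsetP FD) //= /g eF (negbTE eE).
  by rewrite mul0r.
rewrite Ex_prod -prodr_const (big_setID F) /= (setIidPr FD).
rewrite [X in _ * X]big1 ?mulr1; last first.
  by move=> e; rewrite inE /g => /andP[/negbTE -> _]; ring.
by apply: eq_bigr => e eF; rewrite /g eF mulr0 addr0 mulr1.
Qed.

(** n^n / n! is a single term of the exponential series at [n]. *)
Lemma expn_expR_fact n : (0 < n)%N -> n%:R ^+ n <= expR n%:R * n`!%:R :> R.
Proof.
case: n => // n _; have := @expR_ge1Dxn R n.+1%:R n (ler0n _ _).
have f0 : (0 : R) < (n.+1)`!%:R by rewrite ltr0n fact_gt0.
rewrite -ler_pdivrMr //; lra.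
Qed.

Lemma ffact_leX m k : (m ^_ k <= m ^ k)%N.
Proof.
by elim: k => [|k IH]; rewrite ?ffactn0 // ffactnSr expnSr leq_mul // leq_subr.
Qed.

Lemma bin_le_expR a b : (0 < b)%N -> 'C(a, b)%:R <= (expR 1 * a%:R / b%:R) ^+ b :> R.
Proof.
move=> b0; have bR : (0 : R) < b%:R by rewrite ltr0n.
rewrite expr_div_n ler_pdivlMr ?exprn_gt0 // exprMn -expRM_natl mulr1.
apply: le_trans (ler_wpM2l _ (expn_expR_fact b0)) _; first exact: ler0n.
rewrite mulrCA ler_wpM2l ?expR_ge0 // -natrM -natrX ler_nat bin_ffact.
exact: ffact_leX.
Qed.

(** The left side is the expected number of choices of a [t]-set and [m] edges present inside it. As
    [t <= m], t^2 / m is at most [t]. *)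
Lemma sparse_term_le n t m (p : R) : (0 < t)%N -> (t <= m)%N -> 0 <= p ->
  'C(n, t)%:R * ('C('C(t, 2), m)%:R * p ^+ m) <=
  (expR 1 * n%:R / t%:R) ^+ t * (expR 1 * t%:R * p) ^+ m.
Proof.
move=> t0 tm p0; have tR : (0 : R) < t%:R by rewrite ltr0n.
have mR : (0 : R) < m%:R by rewrite ltr0n (leq_trans t0).
apply: ler_pM; rewrite ?mulr_ge0 ?exprn_ge0 ?bin_le_expR // [leRHS]exprMn.
apply: ler_wpM2r; first exact: exprn_ge0.
apply: le_trans (bin_le_expR _ (leq_trans t0 tm)) _.
apply: lerXn2r; rewrite ?nnegrE ?divr_ge0 ?mulr_ge0 ?expR_ge0 //.
rewrite -mulrA; apply: ler_wpM2l; first exact: expR_ge0.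
rewrite ler_pdivrMr // -natrM ler_nat.
have : ('C(t, 2) <= t ^ 2)%N.
  by apply: leq_trans (ffact_leX t 2); rewrite -bin_ffact leq_pmulr.
by move=> /leq_trans; apply; rewrite expnS expn1 leq_mul2l tm orbT.
Qed.

(* With [rho := 3/2 - 1/(2M)] the exponent of [n] in [n t^(rho-1) p^rho] is at most [-delta/2]
   as long as [t <= n^(1/2+delta)] and [p <= n^(-5/6-delta)]. *)
Lemma sparse_term_decay n t m M (p delta : R) :
  (0 < t)%N -> (0 < n)%N -> (0 < M)%N -> ((3 * M - 1) * t <= 2 * M * m)%N ->
  0 < p -> 0 < delta -> 1 <= M%:R * delta -> 3 <= ln n%:R :> R ->
  p <= expR (- (5 / 6 + delta) * ln n%:R) ->
  t%:R <= expR ((2^-1 + delta) * ln n%:R) ->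
  (expR 1 * n%:R / t%:R) ^+ t * (expR 1 * t%:R * p) ^+ m <=
  expR (3 - delta / 2 * ln n%:R) ^+ t.
Proof.
move=> t0 n0 M0 htm p0 d0 Md l3 hp ht.
have tR : (0 : R) < t%:R by rewrite ltr0n.
have nR : (0 : R) < n%:R by rewrite ltr0n.
have MR : (1 : R) <= M%:R by rewrite ler1n.
set lx := ln n%:R in l3 hp ht *; pose lt : R := ln t%:R; pose lp := ln p.
have hlt : lt <= (2^-1 + delta) * lx by rewrite -ler_expR lnK.
have hlp : lp <= - (5 / 6 + delta) * lx by rewrite -ler_expR lnK.
have -> : expR 1 * n%:R / t%:R = expR (1 + lx - lt) by rewrite expRB expRD !lnK.
have -> : expR 1 * t%:R * p = expR (1 + lt + lp) by rewrite !expRD !lnK.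
rewrite -!expRM_natl -expRD ler_expR.
have {}htm : (3 * M%:R - 1) * t%:R <= 2 * M%:R * m%:R :> R.
  move: htm; rewrite -(ler_nat R) !natrM natrB ?natrM //.
  by rewrite muln_gt0.
pose A := 1 + lt + lp; pose g : R := (2 * M%:R)^-1.
have gM : g * M%:R = 2^-1 by rewrite /g; field; lra.
have g0 : 0 < g by rewrite /g invr_gt0; lra.
have gd : g <= delta / 2.
  have : g * 1 <= g * (M%:R * delta) by rewrite ler_wpM2l // ltW.
  by rewrite mulrA gM; lra.
have A0 : A <= 0.
  by rewrite /A; lra.
have rho : (3 / 2 - g) * t%:R <= m%:R.
  have : g * ((3 * M%:R - 1) * t%:R) <= g * (2 * M%:R * m%:R) by rewrite ler_wpM2l // ltW.
  have -> : g * ((3 * M%:R - 1) * t%:R) = 3 * (g * M%:R) * t%:R - g * t%:R by ring.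
  have -> : g * (2 * M%:R * m%:R) = 2 * (g * M%:R) * m%:R by ring.
  by rewrite gM; lra.
have mA : m%:R * A <= (3 / 2 - g) * t%:R * A by rewrite ler_wnM2r.
apply: (@le_trans _ _ (t%:R * (1 + lx - lt + (3 / 2 - g) * A))).
  by rewrite [leRHS]mulrDr lerD2l (mulrCA t%:R) mulrA.
apply: ler_wpM2l; first exact: ltW.
have gle : g <= 2^-1 by rewrite -gM ler_peMr // ltW.
(* The powers of [n] sum to 1 + (1/2 - g)(1/2 + delta) - (3/2 - g)(5/6 + delta) = -delta + g/3, at
   most -delta/2; the constants sum to at most 3. *)
have h1 : (3 / 2 - g - 1) * lt <= (3 / 2 - g - 1) * ((2^-1 + delta) * lx).
  by rewrite ler_wpM2l //; lra.
have h2 : (3 / 2 - g) * lp <= (3 / 2 - g) * (- (5 / 6 + delta) * lx).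
  by rewrite ler_wpM2l //; lra.
have h3 : g * lx <= delta / 2 * lx by rewrite ler_wpM2r //; lra.
have h4 : 0 <= delta * lx by rewrite mulr_ge0 //; lra.
rewrite /A; lra.
Qed.

Lemma sum_set_card n (f : nat -> R) :
  \sum_(T : {set 'I_n}) f #|T| = \sum_(0 <= t < n.+1) 'C(n, t)%:R * f t.
Proof.
transitivity (\sum_(T : {set 'I_n}) \sum_(0 <= t < n.+1 | t == #|T|) f t).
  apply: eq_bigr => T _; rewrite big_nat1_eq /= ltnS.
  by have := max_card (mem T); rewrite card_ord => ->.
under eq_bigr => T _ do rewrite big_mkcond.
rewrite exchange_big /=; apply: eq_bigr => t _.
rewrite -big_mkcond /= sumr_const.
have -> : 'C(n, t) = #|[set T : {set 'I_n} | #|T| == t]| by rewrite card_draws card_ord.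
rewrite mulr_natl; congr (_ *+ _); apply: eq_card => T.
by rewrite inE unfold_in /= eq_sym.
Qed.

Lemma sum_geometric_le (q : R) N : 0 <= q <= 2^-1 ->
  \sum_(0 <= t < N) q ^+ t <= 2 * (1 - q ^+ N).
Proof.
move=> q01; elim: N => [|N IH]; first by rewrite big_geq // expr0 subrr mulr0.
rewrite big_nat_recr //= exprS.
have : q * q ^+ N <= 2^-1 * q ^+ N by rewrite ler_wpM2r ?exprn_ge0 //; lra.
lra.
Qed.

Lemma sparse_prob n M L (p delta : R) :
  (0 < n)%N -> (0 < M)%N -> 0 < p <= 1 -> 0 < delta -> 1 <= M%:R * delta ->
  3 <= ln n%:R :> R -> p <= expR (- (5 / 6 + delta) * ln n%:R) ->
  L%:R <= expR ((2^-1 + delta) * ln n%:R) ->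
  expR (3 - delta / 2 * ln n%:R) <= 2^-1 ->
  Ex p (pairs n) (fun E => (~~ `[< sparse M L E >])%:R) <=
    2 * expR (3 - delta / 2 * ln n%:R).
Proof.
move=> n0 M0 p01 d0 Md l3 hp hL hq; set q := expR (3 - _) in hq *.
have p0 : 0 <= p <= 1 by lra.
(* [m t] is (3M - 1) t / (2M) rounded up, the least number of edges that violates sparsity on [t]
   vertices. *)
pose m t := (((3 * M - 1) * t + (2 * M - 1)) %/ (2 * M))%N.
have M2 : (0 < 2 * M)%N by rewrite muln_gt0.
have m_ge t : ((3 * M - 1) * t <= 2 * M * m t)%N.
  have := ltn_ceil ((3 * M - 1) * t + (2 * M - 1)) M2; rewrite -/(m t).
  move: ((3 * M - 1) * t)%N (m t) (2 * M)%N M2 => a k b b0; rewrite mulSn (mulnC k).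
  by clear -b0; lia.
have m_le t k : ((3 * M - 1) * t <= 2 * M * k)%N -> (m t <= k)%N.
  move=> h; rewrite -ltnS /m ltn_divLR //.
  move: ((3 * M - 1) * t)%N (2 * M)%N M2 h => a b b0; rewrite mulSn (mulnC k).
  by clear -b0; lia.
have le_m t : (t <= m t)%N.
  rewrite -(leq_pmul2l M2); apply: leq_trans (m_ge t).
  by rewrite leq_mul2r; apply/orP; right; clear -M0; lia.
pose PT (T : {set 'I_n}) := [set e : {set 'I_n} | e \subset T & #|e| == 2].
pose f t : R := if (0 < t <= L)%N then 'C('C(t, 2), m t)%:R * p ^+ m t else 0.
have f0 t : 0 <= f t by rewrite /f; case: ifP => // _; rewrite mulr_ge0 ?exprn_ge0 //; lra.
apply: (@le_trans _ _ (Ex p (pairs n) (fun E => \sum_(T : {set 'I_n} | (0 < #|T| <= L)%N)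
    \sum_(F in [set F : {set {set 'I_n}} | F \subset PT T & #|F| == m #|T|]) (F \subset E)%:R))).
  apply: Ex_le => // E sE; have [spE|nspE] := boolP `[< sparse M L E >].
    by rewrite sumr_ge0 // => T _; rewrite sumr_ge0.
  have [T [T0 TL eT]] : exists T, [/\ T != set0, (#|T| <= L)%N &
      ((3 * M - 1) * #|T| <= 2 * M * #|edges_in E T|)%N].
    move: nspE => /asboolPn; apply: contra_notP => nT T T0 TL.
    by rewrite ltnNge; apply/negP => h; apply: nT; exists T.
  have [F [sF cF]] : exists F : {set {set 'I_n}}, F \subset edges_in E T /\ #|F| = m #|T|.
    have /m_le := eT; rewrite -bin_gt0 -cards_draws card_gt0 => /set0Pn[F].
    by rewrite inE => /andP[sF /eqP cF]; exists F.
  have ePT : edges_in E T \subset PT T.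
    apply/subsetP => e; rewrite !inE => /andP[eE ->] /=.
    by have := subsetP sE e eE; rewrite inE.
  rewrite (bigD1 T) /=; last by rewrite card_gt0 T0.
  rewrite (bigD1 F) /=; last by rewrite inE cF eqxx andbT (subset_trans sF).
  have -> : F \subset E.
    by apply: subset_trans sF _; apply/subsetP => e; rewrite inE => /andP[].
  by rewrite -addrA lerDl addr_ge0 // sumr_ge0 // => T' _; rewrite sumr_ge0.
rewrite Ex_sum.
apply: (@le_trans _ _ (\sum_(T : {set 'I_n}) f #|T|)).
  rewrite big_mkcond; apply: ler_sum => T _; rewrite /f; case: ifP => // _.
  rewrite Ex_sum (eq_bigr (fun _ => p ^+ m #|T|)) => [|F]; last first.
    rewrite inE => /andP[sF /eqP cF]; rewrite Ex_subset ?cF //.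
    apply: subset_trans sF _; apply/subsetP => e; rewrite !inE; by case/andP.
  by rewrite sumr_const !cards_draws mulr_natl.
(* The empty set contributes 0; the other terms lie below a geometric series of ratio [q]. *)
rewrite sum_set_card big_nat_recl //= {1}/f /= mulr0 add0r.
apply: (@le_trans _ _ (\sum_(0 <= t < n) q * q ^+ t)).
  apply: ler_sum_nat => t _; rewrite -exprS /f; case: ifP => [/andP[_ tL]|_]; last first.
    by rewrite mulr0 exprn_ge0 ?expR_ge0.
  apply: le_trans (sparse_term_le _ _ _ _) _ => //; first lra.
  apply: (@sparse_term_decay n t.+1 (m t.+1) M p delta) => //; first lra.
  by apply: le_trans hL; rewrite ler_nat.
rewrite -big_distrr /= mulrC ler_wpM2r ?expR_ge0 //.
apply: le_trans (sum_geometric_le _ _) _; first by rewrite expR_ge0.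
have : 0 <= q ^+ n by rewrite exprn_ge0 ?expR_ge0.
lra.
Qed.

End Sparsity.

(** * Concentration *)

Section VertexDistance.
Variables (n : nat) (A : {set {set 'I_n}} -> bool).
Implicit Types (E : {set {set 'I_n}}) (S : {set 'I_n}).

Definition agree_off S E E' :=
  [forall e in pairs n, [disjoint e & S] ==> ((e \in E) == (e \in E'))].

Definition reachable E S :=
  [exists E' : {set {set 'I_n}}, [&& E' \subset pairs n, A E' & agree_off S E E']].

(** The least number of vertices at which [E] must be changed to enter [A]. The default [setT] is
    reachable as soon as [A] holds somewhere, since it meets every pair. *)
Definition vdist E := #|[arg min_(S < setT | reachable E S) #|S| ]|.

Variable E0 : {set {set 'I_n}}.
Hypotheses (E0_pairs : E0 \subset pairs n) (AE0 : A E0).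

Lemma reachableT E : reachable E setT.
Proof.
apply/existsP; exists E0; rewrite E0_pairs AE0; apply/forall_inP => e.
rewrite inE => /eqP e2; apply/implyP; rewrite -setI_eq0 setIT => /eqP e0.
by rewrite e0 cards0 in e2.
Qed.

Lemma vdist_le E S : reachable E S -> (vdist E <= #|S|)%N.
Proof. by move=> rS; rewrite /vdist; case: arg_minnP => [|S' _]; [exact: reachableT | exact]. Qed.

Lemma vdist_witness E : exists2 S, reachable E S & #|S| = vdist E.
Proof.
rewrite /vdist; case: arg_minnP => [|S rS _]; first exact: reachableT.
by exists S.
Qed.

Lemma vdist0 E : E \subset pairs n -> A E -> vdist E = 0%N.
Proof.
move=> sE AE; apply/eqP; rewrite -leqn0 -(cards0 'I_n); apply: vdist_le.
apply/existsP; exists E; rewrite sE AE; apply/forall_inP => e _.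
by rewrite eqxx implybT.
Qed.

(** Adding [v] to an optimal set for [E'] gives an admissible set for [E]. *)
Lemma vdist_lipschitz v E E' :
  (forall e, e \in pairs n -> v \notin e -> (e \in E) = (e \in E')) ->
  (vdist E <= vdist E' + 1)%N.
Proof.
move=> EE'; have [S /existsP[F /and3P[sF AF /forall_inP agF]] <-] := vdist_witness E'.
apply: (@leq_trans #|v |: S|); last by rewrite cardsU1 addnC leq_add2l; case: (v \notin S).
apply: vdist_le; apply/existsP; exists F; rewrite sF AF; apply/forall_inP => e ep.
apply/implyP; rewrite -setI_eq0 setIUr setU_eq0 !setI_eq0 disjoint_sym disjoints1 => /andP[ve eS].
by rewrite EE' //; apply: implyP (agF e ep) eS.
Qed.

Definition pairs_below k : {set {set 'I_n}} :=
  [set e in pairs n | [forall i in e, (i < k)%N]].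

Lemma pairs_below0 : pairs_below 0 = set0.
Proof.
apply/setP => e; rewrite !inE; apply/negbTE/negP => /andP[/eqP e2 /forall_inP h].
have /card_gt0P[i /h] : (0 < #|e|)%N by rewrite e2.
by [].
Qed.

Lemma pairs_below_all : pairs_below n = pairs n.
Proof.
apply/setP => e; rewrite !inE; case: eqP => //= _.
by apply/forall_inP => i _.
Qed.

Lemma pairs_belowS k : pairs_below k \subset pairs_below k.+1.
Proof.
apply/subsetP => e; rewrite !inE => /andP[-> /forall_inP h] /=.
by apply/forall_inP => i /h /ltnW.
Qed.

Variables (R : realType) (p : R).
Hypothesis p01 : 0 <= p <= 1.

(** The distance vanishes on [A], so eps m^2 is at most the variance, hence at most [n], and the
    mean [m] is at most [h]. Chebyshev's inequality then bounds the tail beyond 2h. *)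
Lemma vdist_concentration (eps h : R) : 0 < eps -> 0 < h -> n%:R <= eps * h ^+ 2 ->
  eps <= Ex p (pairs n) (fun E => (A E)%:R) ->
  Ex p (pairs n) (fun E => (2 * h < (vdist E)%:R)%R%:R) <= eps.
Proof.
move=> eps0 h0 nh hA; pose f E : R := (vdist E)%:R.
set m := Ex p (pairs n) f.
have var : Ex p (pairs n) (fun E => (f E - m) ^+ 2) <= n%:R.
  rewrite /m -pairs_below_all; apply: block_variance => //.
  - exact: pairs_below0.
  - exact: pairs_belowS.
  move=> k E E' kn /setP EE'; rewrite /f natr1 ler_nat -addn1.
  apply: (@vdist_lipschitz (Ordinal kn)) => e ep ke.
  have := EE' e; rewrite !in_setD.
  suff -> : e \in pairs_below k.+1 = (e \in pairs_below k) by rewrite andNb.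
  rewrite !inE; congr (_ && _); apply/forall_inP/forall_inP => h' i ie; last exact/ltnW/h'.
  have := h' i ie; rewrite ltnS leq_eqVlt => /orP[/eqP ik|//].
  by case/negP: ke; rewrite (_ : Ordinal kn = i) //; apply: val_inj.
have m0 : 0 <= m by apply: Ex_ge0.
have mh : m <= h.
  have : eps * m ^+ 2 <= n%:R.
    apply: le_trans var; apply: (@le_trans _ _ (Ex p (pairs n) (fun E => m ^+ 2 * (A E)%:R))).
      by rewrite ExZ mulrC ler_wpM2l // sqr_ge0.
    apply: Ex_le => // E sE; case AE: (A E); last by rewrite mulr0 sqr_ge0.
    by rewrite mulr1 /f vdist0 // sub0r sqrrN.
  move=> /le_trans /(_ nh); rewrite ler_pM2l // => hm.
  by rewrite -(@ler_pXn2r _ 2) // nnegrE // ltW.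
have h2 : 0 < h ^+ 2 by rewrite exprn_gt0.
rewrite -(ler_pM2l h2) [leRHS]mulrC; apply: le_trans nh; apply: le_trans var.
rewrite -ExZ; apply: Ex_le => // E _; have [hE|_] := boolP (2 * h < _).
  by rewrite mulr1 lerXn2r ?nnegrE //; rewrite /f; lra.
by rewrite mulr0 sqr_ge0.
Qed.

End VertexDistance.

(** * Quantiles and the window of width one *)

Section Concentration.
Variables (R : realType) (n : nat) (p : R).
Implicit Types E : {set {set 'I_n}}.
Hypothesis p01 : 0 <= p <= 1.

(** Among finitely many values there is a least one whose lower tail reaches [eps]; if its strict
    tail did too, the largest value below it would already qualify. *)
Lemma quantile (X : {set {set 'I_n}} -> R) (eps : R) : 0 < eps <= 1 ->
  exists E0 : {set {set 'I_n}}, [/\ E0 \subset pairs n,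
    eps <= Ex p (pairs n) (fun E => (X E <= X E0)%R%:R) &
    Ex p (pairs n) (fun E => (X E < X E0)%R%:R) < eps].
Proof.
move=> eps01.
pose Q (E0 : {set {set 'I_n}}) :=
  (E0 \subset pairs n) && (eps <= Ex p (pairs n) (fun E => (X E <= X E0)%R%:R)).
have [E1 sE1 maxE1] : exists2 E1 : {set {set 'I_n}}, E1 \subset pairs n &
    forall E, E \subset pairs n -> X E <= X E1.
  have := @arg_maxP _ R _ (set0 : {set {set 'I_n}}) (fun E => E \subset pairs n) X (sub0set _).
  by case=> E1 sE1 maxE1; exists E1.
have QE1 : Q E1.
  rewrite /Q sE1 /= (@eq_Ex _ _ _ _ _ (fun=> 1)) ?Ex_cst; first by lra.
  by move=> E sE; rewrite maxE1.
have := @arg_minP _ R _ E1 Q X QE1; case=> E0 /andP[sE0 QE0] minE0; exists E0; split=> //.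
rewrite ltNge; apply/negP => heps.
have [/exists_inP[E2 sE2 ltE2]|] :=
    boolP [exists E2 : {set {set 'I_n}} in powerset (pairs n), X E2 < X E0]; last first.
  rewrite negb_exists_in => /forall_inP nE; move: heps.
  rewrite (@eq_Ex _ _ _ _ _ (fun=> 0)) ?Ex_cst; first by lra.
  by move=> E sE; rewrite (negbTE (nE E _)) // inE.
have := @arg_maxP _ R _ E2 (fun E => (E \subset pairs n) && (X E < X E0)) X.
rewrite inE in sE2; rewrite sE2 ltE2 => /(_ isT); case=> E3 /andP[sE3 ltE3] maxE3.
have /minE0 : Q E3.
  rewrite /Q sE3 /=; apply: le_trans heps _; apply: Ex_le => // E sE.
  rewrite ler_nat; have [lt|//] := boolP (X E < X E0).
  by have /= := maxE3 E; rewrite sE lt => ->.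
by rewrite leNgt ltE3.
Qed.

Lemma chrom_concentration (rel : bool -> R -> R -> Prop) M L (eps h s : R) :
  coloring_rel rel -> (1 < n)%N -> (0 < M)%N -> 0 < eps <= 1 -> 0 < h ->
  n%:R <= eps * h ^+ 2 ->
  Ex p (pairs n) (fun E => (chrom rel E < 3)%R%:R) < eps ->
  3 * M%:R * (2 * h) + 2 <= L%:R ->
  Ex p (pairs n) (fun E => (~~ `[< sparse M L E >])%:R) <= s ->
  exists u, 1 - (2 * eps + s) <=
    Ex p (pairs n) (fun E => ((u <= chrom rel E) && (chrom rel E <= u + 1))%:R).
Proof.
move=> relP n1 M0 eps01 h0 nh lt3 hL hs.
have [E0 [sE0 leE0 ltE0]] := quantile (@chrom R rel n) eps01.
set u := chrom rel E0 in leE0 ltE0; exists u.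
(* Otherwise an event of probability at least [eps] would lie inside one of probability below
   [eps]. *)
have u3 : 3 <= u.
  rewrite leNgt; apply/negP => u3.
  suff /(le_trans leE0) /le_lt_trans /(_ lt3) : Ex p (pairs n) (fun E => (chrom rel E <= u)%R%:R)
      <= Ex p (pairs n) (fun E => (chrom rel E < 3)%R%:R) by rewrite ltxx.
  apply: Ex_le => // E _.
  by rewrite ler_nat; have [Eu|//] := boolP (chrom rel E <= u); rewrite (le_lt_trans Eu u3).
pose A (E : {set {set 'I_n}}) := chrom rel E <= u.
have AE0 : A E0 by exact: lexx.
have eps0 : 0 < eps by lra.
have hd := vdist_concentration sE0 AE0 p01 eps0 h0 nh leE0.
rewrite lerBlDr -[leLHS](Ex_cst p (pairs n)).
(* Union bound: outside the events of falling below [u], of distance above 2h and of non-sparsity,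
   the value lies in the window. *)
apply: (@le_trans _ _ (Ex p (pairs n) (fun E =>
   ((u <= chrom rel E) && (chrom rel E <= u + 1))%:R +
   (((chrom rel E < u)%R%:R + (2 * h < (vdist A E)%:R)%R%:R) +
     (~~ `[< sparse M L E >])%:R)))); last first.
  by rewrite !ExD lerD2l; lra.
apply: Ex_le => // E sE; rewrite -!natrD ler1n !addn_gt0 !lt0b.
have [_|uE] := ltP (chrom rel E) u; first by rewrite orbT.
have [_|dE] := ltP (2 * h) _; first by rewrite !(orbT, orTb).
have [spE|_] := boolP `[< sparse M L E >]; last by rewrite !orbT.
rewrite /= !orbF.
have {}spE := asboolW spE.
have [S /existsP[E' /and3P[sE' AE' /forall_inP agS]] cS] := vdist_witness sE0 AE0 E.
have SL : (3 * M * #|S| + 2 <= L)%N.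
  rewrite -(ler_nat R) natrD !natrM; apply: le_trans hL; rewrite lerD2r.
  by rewrite ler_wpM2l ?mulr_ge0 // cS.
have [U [SU UL indep]] := sparse_closure sE M0 spE SL.
have [T TU T0|c cP] := @three_colorable n E U sE.
  have TL : (#|T| <= L)%N by apply: leq_trans (subset_leq_card TU) UL.
  have := spE T T0 TL; rewrite mulnBl -!mulnA (mulnCA 2) (mulnCA 3) => lt1.
  by rewrite -(ltn_pmul2l M0) (leq_trans lt1) // leq_subr.
apply: (chrom_merge relP n1 u3 AE' _ cP indep) => i j iU jU.
have [ij|ij] := eqVneq i j.
  rewrite -ij setUid; have ns : [set i] \notin pairs n by rewrite inE cards1.
  by rewrite (contraNF (subsetP sE _) ns) (contraNF (subsetP sE' _) ns).
apply/eqP; apply: implyP (agS [set i; j] _) _; first by rewrite inE cards2 ij.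
rewrite -setI_eq0 setIUl setU_eq0 !setI_eq0 !disjoints1.
by rewrite (contra (subsetP SU i) iU) (contra (subsetP SU j) jU).
Qed.

End Concentration.

(** The parameters are eps = n^-delta, h = n^(1/2 + delta/2) and L = n^(1/2 + delta) rounded down.
    Then eps h^2 = n, and n^(delta/2) outgrows the factor lost in the closure. *)
Lemma chrom_concentration_rate (R : realType) (rel : bool -> R -> R -> Prop) n M (p delta : R) :
  coloring_rel rel -> (1 < n)%N -> (0 < M)%N -> 0 < delta <= 1 -> 1 <= M%:R * delta ->
  2048 * 1024 < p * n%:R -> p <= expR (- (5 / 6 + delta) * ln n%:R) ->
  8 <= delta * ln n%:R -> 6 * M%:R + 3 <= expR (delta / 2 * ln n%:R) ->
  exists u, 1 - 4 * expR (3 - delta / 2 * ln n%:R) <=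
    Ex p (pairs n) (fun E => ((u <= chrom rel E) && (chrom rel E <= u + 1))%:R) <= 1.
Proof.
move=> relP n1 M0 d01 Md pn hp dl hM; set lx := ln n%:R in hp dl hM *.
have n0 : (0 : R) < n%:R by rewrite ltr0n ltnW.
have d0 : 0 < delta by lra.
have l8 : 8 <= lx.
  have : 0 <= lx by rewrite ln_ge0 // ler1n ltnW.
  by move=> lx0; apply: le_trans dl _; rewrite ler_piMl //; lra.
have p0 : 0 < p by rewrite -(pmulr_lgt0 _ n0); lra.
have p1 : p <= 1.
  by apply: le_trans hp _; rewrite -[leRHS]expR0 ler_expR mulNr oppr_le0 mulr_ge0 //; lra.
have p01 : 0 <= p <= 1 by rewrite (ltW p0).
pose eps := expR (- (delta * lx)).
have lt3 : Ex p (pairs n) (fun E => (chrom rel E < 3)%R%:R) < eps.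
  apply: le_lt_trans (chrom_lt3_prob relP n1 p01 pn) _.
  rewrite ltr_expR ltrN2; apply: (@le_lt_trans _ _ lx); last exact: ln_sublinear.
  by case/andP: d01 => _ d1; rewrite ler_piMl // (le_trans _ l8).
clear pn.
pose h := expR ((2^-1 + delta / 2) * lx).
pose ell := expR ((2^-1 + delta) * lx); pose L := Num.truncn ell.
pose q := expR (3 - delta / 2 * lx).
have /andP[Lell ellL] : L%:R <= ell < L.+1%:R by apply: truncn_itv; exact: expR_ge0.
have eps01 : 0 < eps <= 1.
  by rewrite expR_gt0 -[X in _ <= X]expR0 ler_expR; lra.
have nh : n%:R <= eps * h ^+ 2.
  rewrite /eps /h -expRM_natl -expRD -[leLHS]lnK ?posrE // -/lx ler_expR.
  by rewrite le_eqVlt; apply/orP; left; apply/eqP; field.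
have hL : 3 * M%:R * (2 * h) + 2 <= L%:R.
  have : ell = h * expR (delta / 2 * lx) by rewrite /ell /h -expRD; congr expR; field.
  (* With [1 <= h], the spare 3h pays for the added 2 and for the rounding of [ell]. *)
  have h1 : 1 <= h by apply: le_trans (expR_ge1Dx _); rewrite lerDl mulr_ge0; lra.
  have : h * (6 * M%:R + 3) <= h * expR (delta / 2 * lx) by rewrite ler_wpM2l //; lra.
  by move: ellL; rewrite -natr1; lra.
have q2 : q <= 2^-1.
  apply: (@le_trans _ _ (expR (- 1))); first by rewrite ler_expR; lra.
  by rewrite expRN lef_pV2 ?posrE ?expR_gt0 //; have := expR_ge1Dx (1 : R); lra.
have sp : Ex p (pairs n) (fun E => (~~ `[< sparse M L E >])%:R) <= 2 * q.
  by apply: sparse_prob => //; [exact: ltnW | lra | rewrite -/lx; lra].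
have h0 : 0 < h by exact: expR_gt0.
have [u hu] := chrom_concentration p01 relP n1 M0 eps01 h0 nh lt3 hL sp.
exists u; apply/andP; split.
  have : eps <= q by rewrite ler_expR; lra.
  by move: hu; rewrite -/q; lra.
by rewrite -[leRHS](Ex_cst p (pairs n)); apply: Ex_le => // E _; rewrite lern1 leq_b1.
Qed.

(** * Passage to the limit *)

Lemma near_le_ln (R : realType) (K : R) : (\forall n \near \oo, K <= ln (n%:R : R))%classic.
Proof.
near=> n; have hn : expR K <= n%:R by near: n; exact: nbhs_infty_ger.
by rewrite -[leLHS]expRK ler_ln ?posrE ?expR_gt0 // (lt_le_trans _ hn) ?expR_gt0.
Unshelve. all: by end_near.
Qed.

Local Open Scope classical_set_scope.

Theorem theorem3 (R : realType) :
  exists c0 : R, 0 < c0 /\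
  forall (delta : R), 0 < delta ->
  forall p : nat -> R,
    (\forall n \near \oo,
        c0 / n%:R < p n /\ p n <= powR (n%:R) (- (5 / 6) - delta)) ->
  forall X : forall n : nat, {set {set 'I_n}} -> R,
    (X = @theta_half R \/ X = @theta_bar R \/ X = @theta_2 R) ->
    exists u : nat -> R,
      gnp_prob (p n) (fun E => (u n <= X n E) && (X n E <= u n + 1))
        @[n --> \oo] --> (1 : R).
Proof.
have [c [c0 cE]] : exists c : R, 0 < c /\ c = 2048 * 1024 
  by exists (2048 * 1024); split; [lra | reflexivity].
exists c; split=> //.
move=> delta delta0 p hp X hX.
have [rel [relP XE]] : exists rel, coloring_rel rel /\
    forall n (E : {set {set 'I_n}}), E \subset pairs n -> X n E = chrom rel E.
  case: hX => [->|[->|->]].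
  - by exists (@half_rel R); split; [exact: half_relP | move=> n E; exact: theta_half_chrom].
  - by exists (@bar_rel R); split; [exact: bar_relP | move=> n E; exact: theta_bar_chrom].
  - by exists (@rigid_rel R); split; [exact: rigid_relP | move=> n E; exact: theta_2_chrom].
(* The rate needs an exponent at most 1; lowering it only relaxes the upper bound on [p]. *)
pose d := Num.min delta 1.
have d01 : 0 < d <= 1 by rewrite lt_min delta0 ltr01 ge_min lexx orbT.
have dd : d <= delta by rewrite ge_min lexx.
pose M := (Num.truncn d^-1).+1.
have Md : 1 <= M%:R * d.
  have /andP[_ /ltW h] : (Num.truncn d^-1)%:R <= d^-1 < M%:R.
    by apply: truncn_itv; rewrite invr_ge0; lra.
  by rewrite -ler_pdivrMr ?div1r //; lra.
pose good n u := 1 - 4 * expR (3 - d / 2 * ln n%:R) <=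
  gnp_prob (p n) (fun E => (u <= X n E) && (X n E <= u + 1)) <= 1.
have good_near : \forall n \near \oo, exists u, good n u.
  near=> n.
  have [pl pu] : c / n%:R < p n /\ p n <= powR n%:R (- (5 / 6) - delta).
    by near: n.
  have n1 : (1 < n)%N by near: n; exact: nbhs_infty_gt.
  have n0 : (0 : R) < n%:R by rewrite ltr0n ltnW.
  have l8 : 8 / d <= ln (n%:R : R) by near: n; exact: near_le_ln.
  have lM : ln (6 * M%:R + 3) / (d / 2) <= ln (n%:R : R) by near: n; exact: near_le_ln.
  have l0 : 0 <= ln (n%:R : R) by rewrite ln_ge0 // ler1n ltnW.
  have [u hu] : exists u, 1 - 4 * expR (3 - d / 2 * ln n%:R) <=
      Ex (p n) (pairs n) (fun E => ((u <= chrom rel E) && (chrom rel E <= u + 1))%:R) <= 1.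
    apply: (@chrom_concentration_rate _ _ _ M _ _ relP) => //.
    - by rewrite -cE -ltr_pdivrMr.
    - apply: le_trans pu _; rewrite /powR (gt_eqF n0) ler_expR ler_wpM2r //; lra.
    - by rewrite mulrC -ler_pdivrMr //; lra.
    - have M3 : 0 < 6 * M%:R + 3 :> R by rewrite ltr_wpDl // mulr_ge0.
      rewrite -[leLHS]lnK ?posrE // ler_expR (mulrC (d / 2)) -ler_pdivrMr //; lra.
  exists u; rewrite /good gnp_probE.
  by under eq_Ex => E sE do rewrite (XE n E sE).
(* The finitely many [n] that may lack a good value get the arbitrary value 0. *)
have /boolp.choice[u hu] : forall n, exists v, (exists w, good n w) -> good n v.
  move=> n; have [[v gv]|nv] := pselect (exists v, good n v); first by exists v.
  by exists 0.
exists u; apply/cvgrPdist_le => e e0; near=> n.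
have /andP[lo hi] : good n (u n) by apply: hu; near: n.
have le_ln : (3 - ln (e / 4)) / (d / 2) <= ln (n%:R : R) by near: n; exact: near_le_ln.
rewrite ger0_norm ?subr_ge0 // lerBlDl -lerBlDr; apply: le_trans lo.
rewrite lerD2l lerN2 -ler_pdivlMl // [leRHS]mulrC -[leRHS]lnK ?posrE ?divr_gt0 // ler_expR.
by move: le_ln; rewrite ler_pdivrMr; lra.
Unshelve. all: by end_near.
Qed.
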